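(* For positive integers $m$ and $n$ with $\frac{1}{3}\binom{m}{2} \leqslant n \leqslant \binom{m}{2}$, we have \[Z_{2,2}(m,n) = \begin{cases} \left\lfloor\tfrac{1}{14}m(3m-4)+\tfrac{12}{7}n\right\rfloor & \text{if $m$ is even and $n \leqslant \left\lfloor\tfrac{1}{3}\binom{m}{2}+\frac{m}{3}\right\rfloor$,} \\[1.5mm] \left\lfloor\tfrac{1}{4}m(m-1)+\tfrac{3}{2}n\right\rfloor-1 & \text{if $m \equiv 5 \pmod{6}$ and $n = \left\lceil\tfrac{1}{3}\binom{m}{2}\right\rceil$,} \\[1.5mm] \left\lfloor\tfrac{1}{4}m(m-1)+\tfrac{3}{2}n\right\rfloor & \text{otherwise.} \end{cases} \]
   Context: A hypergraph $H$ consists of a finite set $V(H)$ of vertices and a multiset $E(H)$ of edges, each edge being a nonempty subset of $V(H)$. The total degree of $H$ is $\sum_{E\in E(H)}|E|$. $H$ is linear if each pair of distinct vertices lies together in at most one edge (counted with multiplicity). For positive integers $m,n$, the Zarankiewicz number $Z_{2,2}(m,n)$ is the maximum total degree of a linear hypergraph with $m$ vertices and $n$ edges (equivalently, the maximum number of edges of a bipartite graph with parts of sizes $m$ and $n$ containing no $K_{2,2}$). *)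

(* Defs.v *)
From HB Require Import structures.
From mathcomp Require Import all_boot all_order all_algebra.
From mathcomp Require Import finmap multiset.
From mathcomp Require Import boolp.

Set Implicit Arguments.
Unset Strict Implicit.
Unset Printing Implicit Defensive.

Local Open Scope mset_scope.
Local Open Scope nat_scope.

Record hypergraph := Hypergraph {
  vertex : finType;
  edges : {mset {set vertex}};
  edges_nonempty : forall e : {set vertex}, e \in edges -> e != set0 }.

(* Multisets coerce to the sequence of their elements, repeated according to
   multiplicity, so [size], [count] and [\sum_(e <- _)] count multiplicities. *)
Definition total_degree (H : hypergraph) : nat := \sum_(e <- edges H) #|e|.

Definition linear_hypergraph (H : hypergraph) : Prop :=
  forall x y : vertex H, x != y ->
    count (fun e : {set vertex H} => (x \in e) && (y \in e)) (edges H) <= 1.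

Definition linear_total_degree (m n d : nat) : Prop :=
  exists H : hypergraph,
    [/\ linear_hypergraph H, #|vertex H| = m, size (edges H) = n
      & total_degree H = d].

(* The range of [d] is no restriction, since a hypergraph with m vertices and n
   edges has total degree at most m * n; see [Z22_attained] and [Z22_ub]. *)
Definition Z22 (m n : nat) : nat :=
  \max_(d < (m * n).+1 | `[< linear_total_degree m n d >]) d.

Lemma linear_total_degree_le m n d : linear_total_degree m n d -> d <= m * n.
Proof.
move=> [H [_ <- <- <-]]; rewrite /total_degree.
elim: (enum_mset _) => [|e s IHs]; first by rewrite big_nil.
by rewrite big_cons /= mulnS leq_add // max_card.
Qed.

Lemma linear_total_degree_ex m n :
  0 < m -> exists d, linear_total_degree m n d.
Proof.
case: m => // m _.
pose E : {mset {set 'I_m.+1}} := msetn n [set ord0].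
have EE : E = nseq n [set ord0] :> seq _ by rewrite enum_msetn.
have E0 e : e \in E -> e != set0.
  rewrite -[e \in E]/(e \in enum_mset E) EE mem_nseq => /andP[_ /eqP->].
  by apply/set0Pn; exists ord0; rewrite inE.
exists (total_degree (Hypergraph E0)), (Hypergraph E0); split=> //=.
- move=> x y xy /=; rewrite EE count_nseq !inE.
  case: eqP => [x0|_] //=; case: eqP => [y0|_] //=.
  by rewrite x0 y0 eqxx in xy.
- by rewrite card_ord.
- by rewrite EE size_nseq.
Qed.

Lemma Z22_ub m n d : linear_total_degree m n d -> d <= Z22 m n.
Proof.
move=> md; have ltd : d < (m * n).+1 by exact: linear_total_degree_le md.
by apply: (@leq_bigmax_cond _ _ _ (Ordinal ltd)); apply/asboolP.
Qed.

Lemma Z22_attained m n : 0 < m -> linear_total_degree m n (Z22 m n).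
Proof.
move=> /(@linear_total_degree_ex m n)[d md].
have ltd : d < (m * n).+1 by exact: linear_total_degree_le md.
rewrite /Z22 (bigmax_eq_arg (Ordinal ltd)); last exact/asboolP.
by case: arg_maxnP => [|i /asboolP]; first exact/asboolP.
Qed.

(* Main.v *)
From HB Require Import structures.
From mathcomp Require Import all_boot all_order all_algebra.
From mathcomp Require Import zify ring lra.
From mathcomp Require Import finmap multiset.
Require Import Defs.

(* Upper bounds.  Counting covered pairs gives \sum_e 'C(|e|, 2) <= 'C(m, 2), and
   'C(k, 2) >= 2 k - 3 yields the generic bound.  If m is even, every vertex has
   an odd number m - 1 of other vertices, so it lies on an uncovered pair or in
   an edge of even size; adding this to the count gives the bound with
   denominator 14, tight for edge sizes 2, 3, 4 when the even edges partition the
   vertices.  If m = 5 mod 6 the generic bound would need a decomposition of K_m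
   into triples and exactly one pair, which parity forbids.

   Constructions.  All of them come from group divisible designs with triples as
   blocks and groups of size 2 and 4, that is, type 2^(h-2b) 4^b on 2 h points.
   They exist whenever b = 2 h (h - 1) mod 3, 2 b <= h and 7 b <= 2 h + 20: give
   weight 2 to the points of a transversal design with four groups of sizes
   t, t, t, s (t odd, s <= t) obtained from Z_t, replace its blocks by designs of
   type 2^3 or 2^4, and fill the groups, together with 0, 2 or 4 points at
   infinity, by smaller designs; finitely many small designs start the
   induction.  For odd m, add a point at infinity to every group; otherwise omit
   or break up a few groups and triples, and complete by pairs. *)

Set Implicit Arguments.
Unset Strict Implicit.
Unset Printing Implicit Defensive.

Import Order.TTheory GRing.Theory Num.Theory.
Local Open Scope nat_scope.

(** * Group divisible designs *)

Section GroupDivisible.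
Variables (W : finType).
Implicit Types (A Y : {set W}) (g : W -> nat) (f : W -> W -> W).

Definition triple_op A g f := {in A &, forall x y, g x != g y ->
  [/\ f x y \in A, f y x = f x y, g (f x y) != g x & f x (f x y) = y]}.

Definition group_of A g x := [set y in A | g y == g x].

(* A group divisible design on A: the groups are the fibres of g, all of size 2 or
   4, with b of size 4, and f x y is the third point of the triple through two
   points x and y of different groups. *)
Definition gdd24 A b g f := [/\ triple_op A g f,
  {in A, forall x, #|group_of A g x| \in [:: 2; 4]} &
  #|[set x in A | #|group_of A g x| == 4]| = 4 * b].

Lemma gdd24_empty A g f : A = set0 -> gdd24 A 0 g f.
Proof.
move=> ->; split=> [x y|x|]; rewrite ?inE //.
by apply/eqP; rewrite cards_eq0; apply/eqP/setP => x; rewrite !inE.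
Qed.

End GroupDivisible.

Definition gdd24_exists h b := exists (W : finType) (A : {set W}) g f,
  #|A| = 2 * h /\ gdd24 A b g f.

(** * Transport of designs between point sets *)

(** Listing each set with its marked subset first and matching positions gives mutually inverse
    maps; outside [A] and [A'] they take default values. *)
Lemma ex_set_bij (W W' : finType) (A K : {set W}) (A' K' : {set W'}) :
  K \subset A -> K' \subset A' -> #|A| = #|A'| -> #|K| = #|K'| -> A != set0 ->
  exists (u : W' -> W) (v : W -> W'),
  [/\ {in A', forall x, [/\ u x \in A, (u x \in K) = (x \in K') & v (u x) = x]} &
      {in A, forall x, [/\ v x \in A', (v x \in K') = (x \in K) & u (v x) = x]}].
Proof.
move=> KA KA' eA eK /set0Pn[x0 x0A].
have /card_gt0P[x0' x0A'] : 0 < #|A'| by rewrite -eA; apply/card_gt0P; exists x0.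
have key (T : finType) (B L : {set T}) : L \subset B ->
    let s := enum L ++ enum (B :\: L) in
    [/\ uniq s, s =i B, size s = #|B|
      & forall x, (x \in L) = (index x s < #|L|)].
  move=> LB s; have sE : s =i B.
    move=> x; rewrite mem_cat !mem_enum inE.
    by case: (boolP (x \in L)) => //= /(subsetP LB) ->.
  have us : uniq s.
    rewrite cat_uniq !enum_uniq /= andbT; apply/hasPn => x.
    by rewrite !mem_enum inE => /andP[].
  split=> // [|x]; first by rewrite -(card_uniqP us); apply: eq_card.
  rewrite index_cat mem_enum cardE; case: ifP => xL.
    by rewrite index_mem mem_enum xL.
  by apply/esym/negbTE; rewrite -leqNgt leq_addr.
have [us sE ss sK] := key _ _ _ KA; have [us' sE' ss' sK'] := key _ _ _ KA'.
set s := _ ++ _ in us sE ss sK; set s' := _ ++ _ in us' sE' ss' sK'.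
exists (fun x => nth x0 s (index x s')), (fun x => nth x0' s' (index x s)).
split=> x xA; rewrite -?sE -?sE' -?sE -?sE' in xA *.
  have lx : index x s' < size s by rewrite ss eA -ss' index_mem.
  by split; [apply: mem_nth | rewrite sK sK' eK index_uniq | rewrite index_uniq// nth_index].
have lx : index x s < size s' by rewrite ss' -eA -ss index_mem.
by split; [apply: mem_nth | rewrite sK sK' eK index_uniq | rewrite index_uniq// nth_index].
Qed.

Lemma gdd24_transport (W W' : finType) (A : {set W}) (A' : {set W'}) b g f
    (u : W' -> W) (v : W -> W') :
  {in A', forall x, u x \in A /\ v (u x) = x} ->
  {in A, forall x, v x \in A' /\ u (v x) = x} ->
  gdd24 A b g f ->
  gdd24 A' b (g \o u) (fun x y => v (f (u x) (u y))) /\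
  {in A', forall x, #|group_of A' (g \o u) x| = #|group_of A g (u x)|}.
Proof.
move=> hu hv [op sz nb].
have inju : {in A' &, injective u}.
  by move=> x y xA yA /(congr1 v); rewrite (hu x xA).2 (hu y yA).2.
have injv : {in A &, injective v}.
  by move=> x y xA yA /(congr1 u); rewrite (hv x xA).2 (hv y yA).2.
have gu x : x \in A' -> #|group_of A' (g \o u) x| = #|group_of A g (u x)|.
  move=> xA; rewrite -(card_in_imset (f := u)); last first.
    by move=> y z; rewrite !inE => /andP[yA _] /andP[zA _]; apply: inju.
  apply: eq_card => y; apply/imsetP/idP; rewrite inE.
    by move=> [z]; rewrite inE => /andP[/hu[uz _] /= e ->]; rewrite uz.
  move=> /andP[yA e]; have [vy uvy] := hv _ yA.
  by exists (v y); rewrite // inE vy /= uvy.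
split=> //; split.
- move=> x y xA yA /= gxy; have [uxA _] := hu _ xA; have [uyA vuy] := hu _ yA.
  have [fA fC fg fK] := op _ _ uxA uyA gxy; have [vA uv] := hv _ fA.
  by split=> //; rewrite ?fC ?uv ?fK.
- by move=> x xA; rewrite gu//; apply: sz; have [] := hu _ xA.
rewrite -nb -(card_in_imset (f := u)); last first.
  by move=> y z; rewrite !inE => /andP[yA _] /andP[zA _]; apply: inju.
apply: eq_card => y; apply/imsetP/idP; rewrite inE.
  move=> [z]; rewrite inE => /andP[zA e ->]; have [uz _] := hu _ zA.
  by rewrite uz -gu.
move=> /andP[yA e]; have [vy uvy] := hv _ yA.
by exists (v y); rewrite // inE vy gu //= uvy.
Qed.

(** Filling needs designs having the hole [Y] as a group. There are [h - 2 * b] groups of size 2 and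
    [b] of size 4, so the disjunction says that a group of size [#|Y|] exists, or that [Y] is empty
    and imposes nothing. *)
Lemma gdd24_on (W : finType) (A Y : {set W}) h b : gdd24_exists h b ->
  #|A| = 2 * h -> Y \subset A ->
  [|| #|Y| == 0, (#|Y| == 2) && (2 * b < h) | (#|Y| == 4) && (0 < b)] ->
  exists g f, [/\ gdd24 A b g f, {in Y &, forall x y, g x = g y} &
    {in A :\: Y & Y, forall x y, g x != g y}].
Proof.
move=> [W' [A' [g [f [cA' G]]]]] cA YA cY.
have [A0|A0] := eqVneq A set0.
  have h0 : h = 0 by move: cA; rewrite A0 cards0; lia.
  have b0 : b = 0.
    case: G => _ _; have -> : A' = set0 by apply/eqP; rewrite -cards_eq0 cA'; lia.
    rewrite (_ : [set _ in _ | _] = set0) ?cards0; first by lia.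
    by apply/setP => x; rewrite !inE.
  exists (fun=> 0), (fun x _ => x); split=> [|//|x y].
    by rewrite b0; apply: gdd24_empty.
  by rewrite A0 !inE andbF.
have A'0 : A' != set0.
  by rewrite -card_gt0 cA' -cA card_gt0.
have [K [KA eK Kg]] : exists K : {set W'}, [/\ K \subset A', #|K| = #|Y| &
    Y = set0 \/ exists2 x, x \in A' & K = group_of A' g x].
  have [Y0|Y0] := eqVneq #|Y| 0.
    by exists set0; rewrite sub0set Y0 cards0; split=> //; left; apply: cards0_eq.
  have [x xA ex] : exists2 x, x \in A' & #|group_of A' g x| = #|Y|.
    case: G => _ sz nb; move: cY; rewrite (negbTE Y0) /=.
    case/orP => /andP[/eqP-> hb].
      have [/exists_inP[x xA /eqP e]|] := boolP [exists x in A', #|group_of A' g x| == 2].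
        by exists x.
      rewrite negb_exists_in => /forall_inP al.
      suff : #|A'| = 4 * b by lia.
      rewrite -nb; apply: eq_card => x; rewrite inE; case: (boolP (x \in A')) => //= xA.
      by have := sz _ xA; have := al _ xA; rewrite !inE => /negbTE-> /=.
    have /card_gt0P[x] : 0 < #|[set x in A' | #|group_of A' g x| == 4]| by rewrite nb; lia.
    by rewrite inE => /andP[xA /eqP e]; exists x.
  exists (group_of A' g x); split=> //; last by right; exists x.
  by apply/subsetP => y; rewrite inE => /andP[].
have cAA : #|A'| = #|A| by rewrite cA.
have [u [v [hu hv]]] := ex_set_bij KA YA cAA eK A'0.
have [||G' _] := gdd24_transport (A' := A) (u := u) (v := v) _ _ G.
- by move=> x /hu[].
- by move=> x /hv[].
exists (g \o u), (fun x y => v (f (u x) (u y))); split=> //.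
  move=> x y xY yY; have [xA yA] := (subsetP YA _ xY, subsetP YA _ yY).
  case: Kg => [Y0|[z zA eKz]]; first by rewrite Y0 inE in xY.
  have [_ + _] := hu _ xA; have [_ + _] := hu _ yA; rewrite xY yY eKz !inE.
  by move=> /andP[_ /eqP e1] /andP[_ /eqP e2] /=; rewrite e1 e2.
move=> x y; rewrite inE => /andP[xY xA] yY; have yA := subsetP YA _ yY.
case: Kg => [Y0|[z zA eKz]]; first by rewrite Y0 inE in yY.
have [ux + _] := hu _ xA; have [_ + _] := hu _ yA; rewrite (negbTE xY) yY eKz !inE ux /=.
by move=> /andP[_ /eqP ->] /negbT.
Qed.

(* Filling: part x is the large group containing x, or None if x is a point at
   infinity; the latter form the hole Y.  Each large group together with Y carries
   a design, having Y as one of its groups except for the index i0. *)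
Section Filling.
Variables (W I : finType) (A : {set W}) (part : W -> option I) (i0 : I).
Variables (f0 : W -> W -> W) (g_ : I -> W -> nat) (f_ : I -> W -> W -> W).
Variables (b_ : I -> nat).

Let Y := [set x in A | part x == None].
Let A_ i := [set x in A | (part x == Some i) || (part x == None)].

Hypothesis cross : {in A &, forall x y i j,
  part x = Some i -> part y = Some j -> i != j ->
  [/\ f0 x y \in A, f0 y x = f0 x y, f0 x (f0 x y) = y
    & exists2 k, part (f0 x y) = Some k & k != i]}.
Hypothesis gdd_ : forall i, gdd24 (A_ i) (b_ i) (g_ i) (f_ i).
Hypothesis Yin : forall i, i != i0 -> {in Y &, forall x y, g_ i x = g_ i y}.
Hypothesis Yout : forall i, i != i0 ->
  {in A_ i :\: Y & Y, forall x y, g_ i x != g_ i y}.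

(** Points at infinity are assigned to the index [i0], whose design alone decides how the hole is
    divided. [pickle] turns the pair of index and local label into a label in [nat]. *)
Let own x := odflt i0 (part x).
Let g x := choice.pickle (own x, g_ (own x) x).
Let f x y := match part x, part y with
  | Some i, Some j => if i == j then f_ i x y else f0 x y
  | Some i, None | None, Some i => f_ i x y
  | None, None => f_ i0 x y end.

Let gE x y : (g x == g y) = (own x == own y) && (g_ (own x) x == g_ (own x) y).
Proof.
rewrite /g (inj_eq (pcan_inj choice.pickleK)) xpair_eqE.
by case: eqP => //= ->.
Qed.

Let A_E i x : (x \in A_ i) = (x \in A) && ((part x == Some i) || (part x == None)).
Proof. by rewrite inE. Qed.

Let fE i x y : x \in A_ i -> y \in A_ i ->
  [|| part x != None, part y != None | i == i0] -> f x y = f_ i x y.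
Proof.
rewrite !A_E /f; case: (part x) (part y) => [j|] [k|] /=;
  rewrite ?orbF ?andbT ?andbF //=.
- by move=> /andP[_ /eqP[->]] /andP[_ /eqP[->]]; rewrite eqxx.
- by move=> /andP[_ /eqP[->]].
- by move=> _ /andP[_ /eqP[->]].
- by move=> _ _ /eqP->.
Qed.

Let own_out i x y : i != i0 -> x \in A_ i -> part x != None -> y \in A ->
  part y = None -> g_ i x != g_ i y.
Proof.
move=> ii0 xA xN yA yN; apply: Yout => //; rewrite !inE ?yA ?yN //.
by move: xA; rewrite A_E => /andP[-> ->]; rewrite (negbTE xN).
Qed.

Let groupE x : x \in A -> group_of A g x = group_of (A_ (own x)) (g_ (own x)) x.
Proof.
move=> xA; apply/setP => y; rewrite inE eq_sym gE inE A_E.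
case yA: (y \in A) => //=; rewrite (eq_sym (g_ _ y)).
have [e|e] := eqVneq (g_ (own x) x) (g_ (own x) y); rewrite ?andbF // !andbT.
rewrite /own in e *; case px: (part x) e => [i|] /=; case py: (part y) => [j|] //=.
- by rewrite orbF => _; rewrite [RHS]eq_sym.
- move=> e; have [//|ii0] := eqVneq i i0.
  suff /eqP : g_ i x != g_ i y by [].
  by apply: own_out; rewrite // ?A_E ?xA ?px ?eqxx.
- by rewrite orbF => _; rewrite [RHS]eq_sym.
- by rewrite eqxx.
Qed.

Let fill_op : triple_op A g f.
Proof.
move=> x y xA yA; rewrite gE => gxy.
have [[i [j [px py ij]]]|] : (exists i j, [/\ part x = Some i, part y = Some j & i != j])
    \/ exists i, [/\ x \in A_ i, y \in A_ i, g_ i x != g_ i y &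
       [|| part x != None, part y != None | i == i0]].
- move: gxy; rewrite /own; case px: (part x) => [i|]; case py: (part y) => [j|] /=.
  + have [ji|ij] := eqVneq i j; last by left; exists i, j.
    by rewrite /= => e; right; exists i; rewrite !A_E xA yA px py -ji !eqxx.
  + move=> e; right; exists i; rewrite !A_E xA yA px py !eqxx; split=> //.
    have [ii0|ii0] := eqVneq i i0; first by move: e; rewrite -ii0 eqxx.
    by apply: own_out; rewrite // ?A_E ?xA ?px ?eqxx.
  + move=> e; right; exists j; rewrite !A_E xA yA px py !eqxx; split=> //.
    have [ii0|ii0] := eqVneq j i0; first by move: e; rewrite -ii0 eqxx.
    by rewrite eq_sym; apply: own_out; rewrite // ?A_E ?yA ?py ?eqxx.
  + by rewrite eqxx /= => e; right; exists i0; rewrite !A_E xA yA px py !eqxx.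
- have fxy : f x y = f0 x y by rewrite /f px py (negbTE ij).
  have fyx : f y x = f0 y x by rewrite /f px py eq_sym (negbTE ij).
  have [fA fC fK [k pk ki]] := cross xA yA px py ij.
  rewrite fyx fxy; split=> //; first by rewrite gE /own pk px /= (negbTE ki).
  by rewrite /f px pk eq_sym (negbTE ki).
move=> [i [xAi yAi gi pxy]].
have [op _ _] := gdd_ i; have [fA fC fg fK] := op _ _ xAi yAi gi.
have [zA zi] : f_ i x y \in A /\
    (part (f_ i x y) = Some i \/ part (f_ i x y) = None).
  by move: fA; rewrite A_E => /andP[-> /orP[/eqP->|/eqP->]]; split; auto.
have pyx : [|| part y != None, part x != None | i == i0] by rewrite orbCA.
rewrite (fE xAi yAi pxy) (fE yAi xAi pyx) fC; split=> //.
  rewrite gE /own; move: xAi; rewrite A_E xA /=.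
  case: (zi) => pz; rewrite pz /= => /orP[/eqP px|/eqP px]; rewrite px /=.
  - by rewrite eqxx.
  - by case: eqP.
  - by case: eqP => //= ->.
  - have [<-|ii0] := eqVneq i i0; first by rewrite eqxx.
    by move: fg; rewrite (Yin ii0 (x := f_ i x y) (y := x)) ?eqxx // !inE ?zA ?xA ?pz ?px.
rewrite (@fE i)//.
have [->|ii0] := eqVneq i i0; first by rewrite !orbT.
have [px|] := eqVneq (part x) None; last by [].
have [pz|] := eqVneq (part (f_ i x y)) None; last by [].
by move: fg; rewrite (Yin ii0 (x := f_ i x y) (y := x)) ?eqxx // !inE ?zA ?xA ?pz ?px.
Qed.

Let Y_group i x : i != i0 -> x \in Y -> group_of (A_ i) (g_ i) x = Y.
Proof.
move=> ii0 xY; apply/setP => y; rewrite inE.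
have YA : Y \subset A_ i.
  by apply/subsetP => z; rewrite A_E inE => /andP[-> ->]; rewrite orbT.
have [yY|yY] := boolP (y \in Y); first by rewrite (subsetP YA) // (Yin ii0 yY xY) eqxx.
apply/negbTE/negP => /andP[yA /eqP e].
have : g_ i y != g_ i x by apply: Yout; rewrite // inE yY yA.
by rewrite e eqxx.
Qed.

Let B_ i := [set x in A_ i | #|group_of (A_ i) (g_ i) x| == 4].

(** Each design with index other than [i0] counts a four-point hole among its quadruples, and the
    glued design keeps none of these copies; the second summand restores them. *)
Let fill_count : #|[set x in A | #|group_of A g x| == 4]| + 4 * (#|Y| == 4) * #|I|.-1
  = 4 * \sum_i b_ i.
Proof.
have -> : #|[set x in A | #|group_of A g x| == 4]| = \sum_i #|[set x in B_ i | own x == i]|.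
  rewrite -sum1_card (partition_big own predT) //=; apply: eq_bigr => i _.
  rewrite -sum1_card; apply: eq_bigl => x; rewrite !inE.
  case: (boolP (x \in A)) => //= xA; case: (eqVneq (own x) i) => [<-|]; rewrite ?andbF//.
  rewrite !andbT groupE // /own; case: (part x) => [j|] //=; rewrite ?eqxx ?orbT //=.
have -> : #|I|.-1 = \sum_(i | i != i0) 1.
  by rewrite sum1_card -(cardC1 i0); apply: eq_card => x.
rewrite [in LHS](bigD1 i0) //= [in RHS](bigD1 i0) //= mulnDr -addnA.
rewrite [in LHS]big_distrr -big_split [in RHS]big_distrr /=.
congr (_ + _).
  have [_ _ <-] := gdd_ i0; apply: eq_card => x; rewrite !inE /own.
  case: (part x) => [j|] /=; last by rewrite !eqxx !andbT.
  by rewrite -[Some j == _]/(j == i0); case: (j == i0); rewrite ?andbF ?andbT.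
apply: eq_bigr => i ii0; have [_ _ <-] := gdd_ i; rewrite -/(B_ i).
rewrite -(cardsID Y (B_ i)) addnC muln1; congr (_ + _).
  have [Y4|Y4] := eqVneq #|Y| 4.
    rewrite muln1 -[LHS]Y4; apply: eq_card => x; rewrite [RHS]inE.
    case: (boolP (x \in Y)) => xY; rewrite ?andbF // andbT /B_ inE Y_group // Y4 eqxx andbT.
    by move: xY; rewrite inE A_E => /andP[-> ->]; rewrite orbT.
  apply/esym/eqP; rewrite muln0 cards_eq0 -subset0; apply/subsetP => x.
  rewrite 3!inE => /andP[/andP[_ x4] xY].
  by move: x4; rewrite Y_group // (negbTE Y4).
apply: eq_card => x; rewrite !inE /own.
case: (part x) => [j|] /=; rewrite ?(eq_sym i0) ?(negbTE ii0) ?orbF ?andbF //=; last first.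
  by case: (x \in A).
rewrite -[Some j == _]/(j == i); case: (j == i); rewrite ?andbF ?andbT //.
Qed.

Lemma gdd24_fill b : \sum_i b_ i = b + (#|Y| == 4) * #|I|.-1 ->
  exists g f, gdd24 A b g f.
Proof.
move=> sb; exists g, f; split; first exact: fill_op.
  move=> x xA; rewrite groupE //; have [_ sz _] := gdd_ (own x); apply: sz.
  by rewrite A_E xA /own; case: (part x) => [j|]; rewrite /= ?eqxx ?orbT.
by move: fill_count; rewrite sb; lia.
Qed.

End Filling.

(** * Designs certified by computation *)

(** [a + b + c - x - y] is the remaining point of the triple. The default [x] for an uncovered pair
    fails the certificate, which wants the third point outside the group of [x]. *)
Definition third_in (ts : seq (nat * nat * nat)) x y :=
  foldr (fun t z => let: (a, b, c) := t in
    if [|| x == a, x == b | x == c] && [|| y == a, y == b | y == c]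
    then a + b + c - x - y else z) x ts.

(** A label is half the first element of the group, so quadruples get labels below [2 * b] and pairs
    get labels from there on. *)
Definition std_group b x := if x < 4 * b then (x %/ 4).*2 else x./2.

Definition gdd24_cert h b ts := let P := iota 0 (2 * h) in
  [&& 4 * b <= 2 * h,
      all (fun x => count (fun y => std_group b y == std_group b x) P
                    == if x < 4 * b then 4 else 2) P &
      all (fun x => all (fun y => (std_group b x == std_group b y) ||
        let z := third_in ts x y in
        [&& z < 2 * h, third_in ts y x == z, std_group b z != std_group b x
          & third_in ts x z == y]) P) P].

(** The ordinal type may exceed [2 * h], so that [triples_2p3] and [triples_2p4] can later act on
    the same type ['I_8]. *)
Lemma gdd24_certP N h b ts : 2 * h <= N.+1 -> gdd24_cert h b ts ->
  gdd24 [set x : 'I_N.+1 | x < 2 * h] b (std_group b)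
    (fun x y => inord (third_in ts x y)).
Proof.
move=> hN /and3P[hb /allP szP /allP opP].
have memP (x : nat) : x < 2 * h -> x \in iota 0 (2 * h) by rewrite mem_iota.
have szE (x : 'I_N.+1) : x < 2 * h ->
    #|group_of [set x : 'I_N.+1 | x < 2 * h] (std_group b) x| = if x < 4 * b then 4 else 2.
  move=> xh; have /eqP <- := szP _ (memP _ xh).
  have -> : iota 0 (2 * h) = [seq i <- iota 0 N.+1 | i < 2 * h].
    rewrite -(subnKC hN) iotaD filter_cat.
    rewrite [X in _ = X ++ _](_ : _ = iota 0 (2 * h)); last first.
      by apply/all_filterP/allP => i; rewrite mem_iota.
    rewrite [X in _ = _ ++ X](_ : _ = [::]) ?cats0 //.
    apply/eqP; rewrite -[_ == _]negbK -has_filter; apply/hasPn => i.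
    by rewrite mem_iota; lia.
  rewrite count_filter -val_enum_ord count_map -sum1_count -sum1_card big_enum_cond /=.
  by apply: eq_bigl => y; rewrite !inE andbC.
split.
- move=> x y; rewrite !inE => xh yh gxy.
  have := allP (opP _ (memP _ xh)) _ (memP _ yh); rewrite (negbTE gxy) /=.
  move=> /and4P[zh /eqP zC zg /eqP zK].
  by rewrite inordK ?(leq_trans zh) // zC zK inord_val.
- by move=> x; rewrite inE => xh; rewrite szE //; case: ifP.
rewrite (_ : [set x in _ | _] = [set widen_ord (leq_trans hb hN) i | i : 'I_(4 * b)]).
  rewrite card_imset ?card_ord // => i j /(congr1 val) /= /val_inj //.
apply/setP => x; rewrite !inE; apply/andP/imsetP.
  move=> [xh]; rewrite szE //; case: ifP => // xb _.
  by exists (Ordinal xb) => //; apply: val_inj.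
move=> [i _ ->] /=; have ib : i < 4 * b by [].
have ih : i < 2 * h by apply: leq_trans hb.
by rewrite ih szE //= ib.
Qed.

Lemma gdd24_exists_cert h b ts : gdd24_cert h b ts -> gdd24_exists h b.
Proof.
move=> /(@gdd24_certP (2 * h) _ _ _ (leqnSn _)) G.
exists 'I_(2 * h).+1, [set x : 'I_(2 * h).+1 | x < 2 * h].
do 2 eexists; split; last exact: G.
have winj : injective (widen_ord (leqnSn (2 * h))).
  by move=> i j /(congr1 val) /= /val_inj.
rewrite -[RHS]card_ord -(card_imset _ winj).
apply: eq_card => x; rewrite inE; apply/idP/imsetP => [xh|[i _ ->] //=].
by exists (Ordinal xh) => //; apply: val_inj.
Qed.

(** * The transversal design with four groups over the integers mod t *)

Section TransversalDesign.
Variable n : nat.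
Local Notation t := n.+1.
Hypothesis t_odd : odd t.

(** Since [t = 2 * n./2 + 1], a solution of [x + x = 0] equals its own multiple by [t], which is
    0. *)
Lemma odd_double_inj : injective (fun x : 'I_t => x + x)%R.
Proof.
have z (x : 'I_t) : (x *+ t = 0)%R.
  by apply: val_inj; rewrite Zp_mulrn /= modnMl.
have d0 (x : 'I_t) : (x + x = 0 -> x = 0)%R.
  move=> xx; have z2 j : j = 2 * n./2 -> (x *+ j = 0)%R.
    by move->; rewrite mulrnA mulr2n xx mul0rn.
  by have := z x; rewrite mulrS z2 ?addr0 //; lia.
move=> x y /eqP; rewrite -subr_eq0 opprD addrACA => /eqP /d0 /eqP.
by rewrite subr_eq0 => /eqP.
Qed.

(* The blocks of the transversal design are labelled by pairs p; block p meets
   the k-th group in the point td_coord k p. *)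
Definition td_coord k (p : 'I_t * 'I_t) : 'I_t := (match k with
  | 0 => p.1 | 1 => p.2 | 2 => p.1 + p.2 | _ => p.1 - p.2 end)%R.

(** Any two of the four linear forms recover the pair; only sum against difference needs the
    injectivity of doubling. *)
Lemma td_coord_inj k l : k < 4 -> l < 4 -> k != l ->
  injective (fun p => (td_coord k p, td_coord l p)).
Proof.
move=> k4 l4 kl [a b] [c d].
have s (u v w z : 'I_t) : (u + v = w + z -> u - v = w - z -> u = w /\ v = z)%R.
  have dbl (x y : 'I_t) : ((x + y) + (x - y) = x + x)%R by rewrite addrACA subrr addr0.
  move=> e1 e2; have uw : u = w.
    by apply: odd_double_inj; rewrite /= -(dbl u v) -(dbl w z) e1 e2.
  by split=> //; move: e1; rewrite uw => /addrI.
move=> e; move: (congr1 fst e) (congr1 snd e) => {e}.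
case: k l k4 l4 kl => [|[|[|[|//]]]] [|[|[|[|//]]]] //= _ _ _ e1 e2.
all: first [by rewrite e1 e2 | by have [-> ->] := s _ _ _ _ e1 e2
  | by have [-> ->] := s _ _ _ _ e2 e1 | idtac].
all: first [move: e2; rewrite e1 => e2 | move: e1; rewrite e2 => {}e2].
all: by first [move/addrI: e2 => -> | move/addIr: e2 => -> | move/addrI/oppr_inj: e2 => ->].
Qed.

Definition td_block k l x y :=
  odflt (ord0, ord0) [pick p | (td_coord k p, td_coord l p) == (x, y)].

(** An injection of a finite set into itself is onto, so the block through two points of different
    groups exists and the default in [td_block] is never taken. *)
Lemma td_blockE k l x y p : k < 4 -> l < 4 -> k != l ->
  (td_block k l x y == p) = ((x, y) == (td_coord k p, td_coord l p)).
Proof.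
move=> k4 l4 kl; have inj := td_coord_inj k4 l4 kl.
rewrite /td_block; case: pickP => [q /eqP e|no]; first by rewrite -e (inj_eq inj) eq_sym.
have [u _ uK] := injF_bij inj; by have := no (u (x, y)); rewrite /= uK eqxx.
Qed.

End TransversalDesign.

(** Alternate faces of an octahedron (the Pasch configuration); the groups are the opposite
    vertices. *)
Definition triples_2p3 := [:: (0,2,4); (0,3,5); (1,2,5); (1,3,4)].
(* The nonzero vectors of F_3^2 with the triples of zero sum; a group is {v, -v}. *)
Definition triples_2p4 :=
  [:: (0,2,5); (0,3,7); (0,4,6); (1,3,4); (1,2,6); (1,5,7); (2,4,7); (3,5,6)].

Lemma inord_eq k (i : 'I_4) : k < 4 -> (inord k == i :> 'I_4) = (k == i).
Proof. by move=> k4; rewrite -val_eqE /= inordK. Qed.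

(* Point x of group k is doubled to (2 k, x) and (2 k + 1, x); in the last group
   only x < s is kept.  The 2 e points at infinity are on the right. *)
Section TruncatedTransversal.
Variables (n s e : nat).
Local Notation t := n.+1.
Hypotheses (t_odd : odd t) (st : s <= t).

Local Notation W := (('I_8 * 'I_t) + 'I_(2 * e))%type.

Definition ttd_valid (u : W) :=
  if u is inl (p, x) then (p./2 == 3) ==> (x < s) else true.
Definition ttd_part (u : W) : option 'I_4 :=
  if u is inl (p, x) then Some (inord p./2) else None.
(** [q] tells whether the block meets the last group in a kept point: if so its four doubled points
    carry the design of type 2^4, otherwise the first three carry the one of type 2^3. *)
Definition ttd_small (q : bool) (p r : 'I_8) : 'I_8 :=
  inord (third_in (if q then triples_2p4 else triples_2p3) p r).
(** The block [ab] through the undoubled points comes first; the small design on it then names the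
    third point. Values at infinity or inside a group are arbitrary, since filling uses this
    operation across parts only. *)
Definition ttd_op (u v : W) : W := match u, v with
  | inl (p, x), inl (r, y) =>
    let ab := td_block p./2 r./2 x y in
    let z := ttd_small (td_coord 3 ab < s) p r in inl (z, td_coord z./2 ab)
  | _, _ => u end.

Lemma ttd_half (p : 'I_8) : p./2 < 4.
Proof. by have := ltn_ord p; lia. Qed.

Lemma ttd_smallP q (p r : 'I_8) : p./2 != r./2 ->
  (~~ q -> (p./2 != 3) && (r./2 != 3)) ->
  [/\ ttd_small q r p = ttd_small q p r, (ttd_small q p r)./2 != p./2,
      ttd_small q p (ttd_small q p r) = r
    & (~~ q -> (ttd_small q p r)./2 != 3)].
Proof.
case: q => pr /=.
  move=> _; have [//|op _ _] := @gdd24_certP 7 4 0 triples_2p4 isT.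
  by have [] := op p r; rewrite ?inE ?ltn_ord.
move=> /(_ isT) /andP[p3 r3].
have [//|op _ _] := @gdd24_certP 7 3 0 triples_2p3 isT.
have p6 : p < 6 by have := ltn_ord p; lia.
have r6 : r < 6 by have := ltn_ord r; lia.
have [z6 zC zp zK] : [/\ ttd_small false p r < 6,
  ttd_small false r p = ttd_small false p r, (ttd_small false p r)./2 != p./2
  & ttd_small false p (ttd_small false p r) = r].
  by have [] := op p r; rewrite ?inE.
by split=> // _; lia.
Qed.

Lemma ttd_cross : {in [set u | ttd_valid u] &, forall u v i j,
  ttd_part u = Some i -> ttd_part v = Some j -> i != j ->
  [/\ ttd_op u v \in [set u | ttd_valid u], ttd_op v u = ttd_op u v,
      ttd_op u (ttd_op u v) = v
    & exists2 k, ttd_part (ttd_op u v) = Some k & k != i]}.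
Proof.
move=> [[p x]|//] [[r y]|//] /= + + i j [<-] [<-]; rewrite !inE /= => px ry.
rewrite inord_eq ?ttd_half // inordK ?ttd_half // => pr.
set ab := td_block _ _ x y; set q := td_coord 3 ab < s.
have /eqP[xE yE] : (x, y) == (td_coord p./2 ab, td_coord r./2 ab).
  by rewrite -(td_blockE t_odd _ _ _ (ttd_half p) (ttd_half r) pr).
have baE : td_block r./2 p./2 y x = ab.
  apply/eqP; rewrite (td_blockE t_odd) ?ttd_half // 1?eq_sym //.
  by rewrite xE yE.
(* A point of the last group is where its block meets that group; being kept, it makes [q] true. *)
have q3 : ~~ q -> (p./2 != 3) && (r./2 != 3).
  rewrite /q => nq; apply/andP; split; apply/eqP => e3.
    by move: px; rewrite e3 /= xE e3 (negbTE nq).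
  by move: ry; rewrite e3 /= yE e3 (negbTE nq).
have [zC zp zK z3] := ttd_smallP pr q3.
set z := ttd_small q p r in zC zp zK z3 *.
have zE : td_block p./2 z./2 x (td_coord z./2 ab) = ab.
  apply/eqP; rewrite (td_blockE t_odd) ?ttd_half // 1?eq_sym //.
  by rewrite {1}xE.
split.
- apply/implyP => /eqP e3; rewrite e3.
  by case: (boolP q) => // /z3; rewrite e3.
- by rewrite baE -/q zC.
- by rewrite zE -/q zK -yE.
by exists (inord z./2) => //; rewrite inord_eq ?ttd_half // inordK ?ttd_half.
Qed.

Lemma ttd_card (P : pred W) : #|[set u | P u]| =
  \sum_(p < 8) \sum_(x < t) P (inl (p, x)) + \sum_(z < 2 * e) P (inr z).
Proof.
rewrite -sum1_card big_mkcond /= big_sumType /= pair_bigA /=.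
by congr (_ + _); apply: eq_bigr => u _; rewrite inE; [case: u => p x|]; case: (P _).
Qed.

Lemma sum_ord_lt : \sum_(x < t) (x < s) = s.
Proof.
rewrite -[RHS]card_ord -sum1_card (big_ord_widen_cond _ (fun=> true) (fun=> 1) st) /=.
by rewrite [RHS]big_mkcond /=; apply: eq_bigr => x _; case: (x < s).
Qed.

Lemma ttd_part_card (i : 'I_4) :
  #|[set u in [set u | ttd_valid u] | (ttd_part u == Some i) || (ttd_part u == None)]|
  = 2 * ((if i < 3 then t else s) + e).
Proof.
under eq_finset => u do rewrite inE.
rewrite ttd_card /= [X in _ + X]sum1_card card_ord.
transitivity (\sum_(p < 8) (p./2 == i) * (if i < 3 then t else s) + 2 * e).
  congr (_ + _); apply: eq_bigr => p _.
  under eq_bigr => x _ do rewrite orbF -[Some _ == _]/(inord p./2 == i) inord_eq ?ttd_half //.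
  case: (p./2 =P i) => [->|_]; last first.
    by rewrite big1 // => x _; rewrite andbF.
  rewrite [RHS]mul1n; case: ltnP => i3.
    have -> : (i == 3 :> nat) = false by apply/eqP => i3'; rewrite i3' in i3.
    by rewrite /= sum1_card card_ord.
  have -> : (i == 3 :> nat) by have := ltn_ord i; lia.
  by under eq_bigr => x _ do rewrite /= andbT; rewrite sum_ord_lt.
case: i => [[|[|[|[|//]]]] i4] /=; rewrite !big_ord_recl big_ord0 /=; lia.
Qed.

Lemma ttd_valid_card : #|[set u | ttd_valid u]| = 2 * (3 * t + s + e).
Proof.
rewrite ttd_card /= [X in _ + X]sum1_card card_ord.
transitivity (\sum_(p < 8) (if p./2 == 3 then s else t) + 2 * e).
  congr (_ + _); apply: eq_bigr => p _.
  by case: eqP => _ /=; rewrite ?sum_ord_lt // sum1_card card_ord.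
by rewrite !big_ord_recl big_ord0 /=; lia.
Qed.

Lemma ttd_inf_card : #|[set u in [set u | ttd_valid u] | ttd_part u == None]| = 2 * e.
Proof.
under eq_finset => u do rewrite inE.
rewrite ttd_card /= [X in _ + X]sum1_card card_ord big1 // => p _.
by rewrite big1 // => x _; rewrite andbF.
Qed.

(** The last group is the index [i0] of the filling, so only the three large groups need the points
    at infinity as a group. For [e = 2] this hole is counted three times as a quadruple, whence the
    term 3. *)
Lemma gdd24_exists_step (b_ : 'I_4 -> nat) b : e <= 2 ->
  (forall i : 'I_4, i < 3 -> gdd24_exists (t + e) (b_ i)) ->
  (forall i : 'I_4, i < 3 ->
     [|| e == 0, (e == 1) && (2 * b_ i < t + e) | (e == 2) && (0 < b_ i)]) ->
  gdd24_exists (s + e) (b_ ord_max) ->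
  \sum_i b_ i = b + (e == 2) * 3 ->
  gdd24_exists (3 * t + s + e) b.
Proof.
move=> e2 F3 H3 F4 sb.
pose A := [set u | ttd_valid u].
pose A_ (i : 'I_4) := [set u in A | (ttd_part u == Some i) || (ttd_part u == None)].
pose Y := [set u in A | ttd_part u == None].
have YA i : Y \subset A_ i.
  by apply/subsetP => u; rewrite !inE => /andP[-> ->]; rewrite orbT.
pose G (i : 'I_4) (gf : (W -> nat) * (W -> W -> W)) :=
  [/\ gdd24 (A_ i) (b_ i) gf.1 gf.2,
      i != ord_max -> {in Y &, forall x y, gf.1 x = gf.1 y} &
      i != ord_max -> {in A_ i :\: Y & Y, forall x y, gf.1 x != gf.1 y}].
have [gf gfP] : exists gf, forall i, G i (gf i).
  apply: (fin_all_exists (P := G)) => i.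
  have [i3|i3] := ltnP i 3.
    have cA : #|A_ i| = 2 * (t + e) by rewrite ttd_part_card i3.
    have [|g [f [Gi gi go]]] := gdd24_on (F3 i i3) cA (YA i); last by exists (g, f).
    by rewrite ttd_inf_card; have := H3 i i3; lia.
  have im : i = ord_max by apply: val_inj => /=; have := ltn_ord i; lia.
  have cA : #|A_ i| = 2 * (s + e) by rewrite ttd_part_card ltnNge i3.
  move: F4; rewrite -im => F4.
  have [|g [f [Gi gi go]]] := gdd24_on F4 cA (sub0set _); first by rewrite cards0.
  by exists (g, f); split; rewrite // im eqxx.
have [||i||g [f Gb]] := @gdd24_fill _ _ A (@ttd_part) ord_max ttd_op
  (fun i => (gf i).1) (fun i => (gf i).2) b_ ttd_cross _ _ _ b.
- by move=> i; have [] := gfP i.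
- by move=> i im; have [_ + _] := gfP i; apply.
- by move=> x y; have [_ _] := gfP i; apply.
- by rewrite ttd_inf_card card_ord sb; congr (_ + _ * _); lia.
by exists W, A, g, f; split=> //; apply: ttd_valid_card.
Qed.

End TruncatedTransversal.

(* Group divisible designs (h, b, triples) of type 2^(h-2b) 4^b found by
   hill climbing. *)
Definition base_designs : seq (nat * nat * seq (nat * nat * nat)) := [::
  (1, 0, [::]);
  (2, 1, [::]);
  (5, 1, [::
    (0,4,9);(0,5,7);(0,6,8);(1,4,6);(1,5,9);(1,7,8);(2,4,7);(2,5,8);(2,6,9);
    (3,4,8);(3,5,6);(3,7,9)]);
  (6, 0, [::
    (0,2,4);(0,3,9);(0,5,11);(0,6,8);(0,7,10);(1,2,6);(1,3,5);(1,4,7);(1,8,10);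
    (1,9,11);(2,5,8);(2,7,11);(2,9,10);(3,4,10);(3,6,11);(3,7,8);(4,6,9);
    (4,8,11);(5,6,10);(5,7,9)]);
  (6, 3, [::
    (0,4,9);(0,5,11);(0,6,10);(0,7,8);(1,4,8);(1,5,10);(1,6,11);(1,7,9);
    (2,4,11);(2,5,8);(2,6,9);(2,7,10);(3,4,10);(3,5,9);(3,6,8);(3,7,11)]);
  (7, 0, [::
    (0,2,11);(0,3,13);(0,4,7);(0,5,9);(0,6,10);(0,8,12);(1,2,8);(1,3,6);(1,4,9);
    (1,5,10);(1,7,13);(1,11,12);(2,4,13);(2,5,6);(2,7,10);(2,9,12);(3,4,11);
    (3,5,8);(3,7,9);(3,10,12);(4,6,12);(4,8,10);(5,7,12);(5,11,13);(6,8,13);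
    (6,9,11);(7,8,11);(9,10,13)]);
  (7, 3, [::
    (0,4,10);(0,5,12);(0,6,8);(0,7,11);(0,9,13);(1,4,8);(1,5,10);(1,6,9);
    (1,7,13);(1,11,12);(2,4,13);(2,5,8);(2,6,11);(2,7,9);(2,10,12);(3,4,11);
    (3,5,9);(3,6,12);(3,7,10);(3,8,13);(4,9,12);(5,11,13);(6,10,13);(7,8,12)]);
  (8, 1, [::
    (0,4,13);(0,5,7);(0,6,10);(0,8,14);(0,9,15);(0,11,12);(1,4,6);(1,5,13);
    (1,7,14);(1,8,12);(1,9,11);(1,10,15);(2,4,15);(2,5,10);(2,6,11);(2,7,9);
    (2,8,13);(2,12,14);(3,4,12);(3,5,15);(3,6,9);(3,7,13);(3,8,11);(3,10,14);
    (4,7,11);(4,8,10);(4,9,14);(5,6,8);(5,9,12);(5,11,14);(6,12,15);(6,13,14);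
    (7,8,15);(7,10,12);(9,10,13);(11,13,15)]);
  (8, 4, [::
    (0,4,12);(0,5,11);(0,6,13);(0,7,9);(0,8,15);(0,10,14);(1,4,11);(1,5,12);
    (1,6,10);(1,7,15);(1,8,13);(1,9,14);(2,4,8);(2,5,13);(2,6,9);(2,7,14);
    (2,10,12);(2,11,15);(3,4,14);(3,5,10);(3,6,15);(3,7,8);(3,9,12);(3,11,13);
    (4,9,13);(4,10,15);(5,8,14);(5,9,15);(6,8,12);(6,11,14);(7,10,13);(7,11,12)]);
  (9, 3, [::
    (0,4,14);(0,5,11);(0,6,8);(0,7,17);(0,9,16);(0,10,13);(0,12,15);(1,4,13);
    (1,5,9);(1,6,10);(1,7,15);(1,8,16);(1,11,14);(1,12,17);(2,4,8);(2,5,17);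
    (2,6,13);(2,7,14);(2,9,15);(2,10,12);(2,11,16);(3,4,10);(3,5,16);(3,6,17);
    (3,7,11);(3,8,14);(3,9,12);(3,13,15);(4,9,17);(4,11,15);(4,12,16);(5,8,13);
    (5,10,15);(5,12,14);(6,9,14);(6,11,12);(6,15,16);(7,8,12);(7,9,13);
    (7,10,16);(8,15,17);(10,14,17);(11,13,17);(13,14,16)]);
  (10, 3, [::
    (0,4,10);(0,5,13);(0,6,14);(0,7,12);(0,8,18);(0,9,15);(0,11,17);(0,16,19);
    (1,4,16);(1,5,9);(1,6,13);(1,7,11);(1,8,17);(1,10,19);(1,12,15);(1,14,18);
    (2,4,11);(2,5,18);(2,6,10);(2,7,14);(2,8,16);(2,9,19);(2,12,17);(2,13,15);
    (3,4,9);(3,5,11);(3,6,19);(3,7,16);(3,8,14);(3,10,12);(3,13,17);(3,15,18);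
    (4,8,13);(4,12,18);(4,14,17);(4,15,19);(5,8,19);(5,10,14);(5,12,16);
    (5,15,17);(6,8,12);(6,9,17);(6,11,15);(6,16,18);(7,8,15);(7,9,18);(7,10,13);
    (7,17,19);(9,12,14);(9,13,16);(10,15,16);(10,17,18);(11,12,19);(11,13,18);
    (11,14,16);(13,14,19)]);
  (11, 4, [::
    (0,4,16);(0,5,9);(0,6,10);(0,7,12);(0,8,18);(0,11,14);(0,13,20);(0,15,19);
    (0,17,21);(1,4,13);(1,5,14);(1,6,21);(1,7,11);(1,8,16);(1,9,15);(1,10,19);
    (1,12,20);(1,17,18);(2,4,10);(2,5,16);(2,6,18);(2,7,19);(2,8,15);(2,9,14);
    (2,11,13);(2,12,21);(2,17,20);(3,4,21);(3,5,12);(3,6,9);(3,7,15);(3,8,20);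
    (3,10,17);(3,11,16);(3,13,19);(3,14,18);(4,8,19);(4,9,12);(4,11,18);
    (4,14,20);(4,15,17);(5,8,17);(5,10,13);(5,11,20);(5,15,18);(5,19,21);
    (6,8,12);(6,11,19);(6,13,17);(6,14,16);(6,15,20);(7,8,14);(7,9,17);
    (7,10,20);(7,13,18);(7,16,21);(8,13,21);(9,13,16);(9,18,21);(9,19,20);
    (10,12,18);(10,14,21);(10,15,16);(11,12,17);(11,15,21);(12,16,19);
    (14,17,19);(16,18,20)]);
  (12, 3, [::
    (0,4,8);(0,5,12);(0,6,18);(0,7,13);(0,9,23);(0,10,16);(0,11,19);(0,14,21);
    (0,15,17);(0,20,22);(1,4,18);(1,5,14);(1,6,9);(1,7,21);(1,8,15);(1,10,19);
    (1,11,12);(1,13,17);(1,16,22);(1,20,23);(2,4,15);(2,5,19);(2,6,23);(2,7,10);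
    (2,8,14);(2,9,12);(2,11,16);(2,13,20);(2,17,21);(2,18,22);(3,4,13);(3,5,8);
    (3,6,15);(3,7,9);(3,10,23);(3,11,20);(3,12,16);(3,14,18);(3,17,22);
    (3,19,21);(4,9,17);(4,10,21);(4,11,22);(4,12,19);(4,14,23);(4,16,20);
    (5,9,22);(5,10,17);(5,11,18);(5,13,16);(5,15,20);(5,21,23);(6,8,17);
    (6,10,20);(6,11,13);(6,12,22);(6,14,19);(6,16,21);(7,8,18);(7,11,23);
    (7,12,17);(7,14,20);(7,15,16);(7,19,22);(8,12,20);(8,13,23);(8,16,19);
    (8,21,22);(9,13,21);(9,14,16);(9,15,18);(9,19,20);(10,12,14);(10,13,18);
    (10,15,22);(11,14,17);(11,15,21);(12,15,23);(12,18,21);(13,14,22);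
    (13,15,19);(16,18,23);(17,18,20);(17,19,23)]);
  (12, 6, [::
    (0,4,9);(0,5,14);(0,6,18);(0,7,23);(0,8,17);(0,10,21);(0,11,15);(0,12,22);
    (0,13,16);(0,19,20);(1,4,15);(1,5,21);(1,6,23);(1,7,20);(1,8,13);(1,9,16);
    (1,10,17);(1,11,19);(1,12,18);(1,14,22);(2,4,18);(2,5,16);(2,6,17);(2,7,11);
    (2,8,14);(2,9,20);(2,10,12);(2,13,23);(2,15,22);(2,19,21);(3,4,22);(3,5,18);
    (3,6,11);(3,7,9);(3,8,19);(3,10,14);(3,12,20);(3,13,17);(3,15,23);(3,16,21);
    (4,8,12);(4,10,20);(4,11,23);(4,13,19);(4,14,16);(4,17,21);(5,8,20);
    (5,9,12);(5,10,23);(5,11,13);(5,15,17);(5,19,22);(6,8,22);(6,9,14);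
    (6,10,19);(6,12,16);(6,13,20);(6,15,21);(7,8,15);(7,10,16);(7,12,21);
    (7,13,18);(7,14,19);(7,17,22);(8,16,23);(8,18,21);(9,13,21);(9,15,19);
    (9,17,23);(9,18,22);(10,13,22);(10,15,18);(11,12,17);(11,14,21);(11,16,22);
    (11,18,20);(12,19,23);(14,17,20);(14,18,23);(15,16,20)]);
  (13, 3, [::
    (0,4,21);(0,5,15);(0,6,19);(0,7,24);(0,8,17);(0,9,12);(0,10,20);(0,11,22);
    (0,13,25);(0,14,16);(0,18,23);(1,4,14);(1,5,13);(1,6,17);(1,7,15);(1,8,24);
    (1,9,22);(1,10,16);(1,11,12);(1,18,20);(1,19,21);(1,23,25);(2,4,9);(2,5,12);
    (2,6,8);(2,7,22);(2,10,21);(2,11,24);(2,13,15);(2,14,20);(2,16,18);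
    (2,17,23);(2,19,25);(3,4,23);(3,5,8);(3,6,9);(3,7,13);(3,10,17);(3,11,19);
    (3,12,14);(3,15,25);(3,16,22);(3,18,21);(3,20,24);(4,8,16);(4,10,19);
    (4,11,25);(4,12,17);(4,13,22);(4,15,20);(4,18,24);(5,9,18);(5,10,25);
    (5,11,14);(5,16,19);(5,17,21);(5,20,23);(5,22,24);(6,10,22);(6,11,18);
    (6,12,16);(6,13,14);(6,15,21);(6,20,25);(6,23,24);(7,8,23);(7,9,20);
    (7,10,14);(7,11,21);(7,12,19);(7,16,25);(7,17,18);(8,12,25);(8,13,21);
    (8,14,18);(8,15,22);(8,19,20);(9,13,19);(9,14,23);(9,15,17);(9,16,24);
    (9,21,25);(10,12,23);(10,13,18);(10,15,24);(11,13,23);(11,15,16);(11,17,20);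
    (12,15,18);(12,20,22);(12,21,24);(13,16,20);(13,17,24);(14,17,25);
    (14,19,24);(14,21,22);(15,19,23);(16,21,23);(17,19,22);(18,22,25)]);
  (13, 6, [::
    (0,4,24);(0,5,15);(0,6,13);(0,7,17);(0,8,22);(0,9,21);(0,10,12);(0,11,18);
    (0,14,25);(0,16,23);(0,19,20);(1,4,19);(1,5,13);(1,6,18);(1,7,23);(1,8,15);
    (1,9,22);(1,10,16);(1,11,24);(1,12,17);(1,14,20);(1,21,25);(2,4,11);
    (2,5,10);(2,6,9);(2,7,22);(2,8,23);(2,12,19);(2,13,18);(2,14,17);(2,15,21);
    (2,16,25);(2,20,24);(3,4,13);(3,5,24);(3,6,25);(3,7,20);(3,8,17);(3,9,23);
    (3,10,14);(3,11,16);(3,12,22);(3,15,18);(3,19,21);(4,8,18);(4,9,14);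
    (4,10,17);(4,12,20);(4,15,23);(4,16,21);(4,22,25);(5,8,12);(5,9,19);
    (5,11,21);(5,14,23);(5,16,22);(5,17,25);(5,18,20);(6,8,14);(6,10,20);
    (6,11,22);(6,12,21);(6,15,16);(6,17,23);(6,19,24);(7,8,16);(7,9,18);
    (7,10,25);(7,11,13);(7,12,24);(7,14,21);(7,15,19);(8,13,19);(8,20,25);
    (8,21,24);(9,12,16);(9,13,25);(9,15,20);(9,17,24);(10,13,23);(10,15,24);
    (10,18,21);(10,19,22);(11,12,23);(11,14,19);(11,15,25);(11,17,20);
    (12,18,25);(13,16,20);(13,17,21);(13,22,24);(14,16,24);(14,18,22);
    (15,17,22);(18,23,24);(19,23,25)]);
  (14, 4, [::
    (0,4,20);(0,5,18);(0,6,26);(0,7,15);(0,8,19);(0,9,24);(0,10,22);(0,11,25);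
    (0,12,23);(0,13,17);(0,14,16);(0,21,27);(1,4,15);(1,5,10);(1,6,8);(1,7,26);
    (1,9,27);(1,11,21);(1,12,19);(1,13,23);(1,14,17);(1,16,22);(1,18,24);
    (1,20,25);(2,4,21);(2,5,20);(2,6,14);(2,7,8);(2,9,18);(2,10,17);(2,11,13);
    (2,12,22);(2,15,23);(2,16,25);(2,19,26);(2,24,27);(3,4,12);(3,5,11);
    (3,6,16);(3,7,27);(3,8,26);(3,9,23);(3,10,25);(3,13,18);(3,14,19);(3,15,20);
    (3,17,24);(3,21,22);(4,8,14);(4,9,16);(4,10,18);(4,11,17);(4,13,26);
    (4,19,25);(4,22,24);(4,23,27);(5,8,21);(5,9,15);(5,12,24);(5,13,27);
    (5,14,23);(5,16,26);(5,17,25);(5,19,22);(6,9,17);(6,10,15);(6,11,20);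
    (6,12,18);(6,13,24);(6,19,27);(6,21,23);(6,22,25);(7,9,22);(7,10,23);
    (7,11,14);(7,12,17);(7,13,25);(7,16,24);(7,18,21);(7,19,20);(8,12,20);
    (8,13,22);(8,15,24);(8,16,27);(8,17,18);(8,23,25);(9,12,26);(9,13,20);
    (9,14,25);(9,19,21);(10,12,21);(10,13,19);(10,14,27);(10,16,20);(10,24,26);
    (11,12,16);(11,15,18);(11,19,24);(11,22,27);(11,23,26);(12,25,27);
    (13,16,21);(14,18,22);(14,20,26);(14,21,24);(15,16,19);(15,17,27);
    (15,21,25);(15,22,26);(16,18,23);(17,19,23);(17,20,22);(17,21,26);
    (18,20,27);(18,25,26);(20,23,24)]);
  (15, 0, [::
    (0,2,28);(0,3,15);(0,4,21);(0,5,22);(0,6,20);(0,7,27);(0,8,12);(0,9,18);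
    (0,10,14);(0,11,26);(0,13,23);(0,16,24);(0,17,29);(0,19,25);(1,2,9);
    (1,3,23);(1,4,25);(1,5,21);(1,6,11);(1,7,19);(1,8,24);(1,10,17);(1,12,16);
    (1,13,28);(1,14,20);(1,15,22);(1,18,26);(1,27,29);(2,4,17);(2,5,24);
    (2,6,16);(2,7,25);(2,8,27);(2,10,23);(2,11,14);(2,12,21);(2,13,19);
    (2,15,20);(2,18,29);(2,22,26);(3,4,6);(3,5,13);(3,7,18);(3,8,29);(3,9,25);
    (3,10,26);(3,11,27);(3,12,28);(3,14,16);(3,17,24);(3,19,20);(3,21,22);
    (4,7,28);(4,8,22);(4,9,14);(4,10,19);(4,11,13);(4,12,27);(4,15,29);
    (4,16,20);(4,18,23);(4,24,26);(5,6,26);(5,7,16);(5,8,18);(5,9,10);(5,11,19);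
    (5,12,14);(5,15,23);(5,17,27);(5,20,28);(5,25,29);(6,8,19);(6,9,13);
    (6,10,15);(6,12,17);(6,14,27);(6,18,21);(6,22,24);(6,23,29);(6,25,28);
    (7,8,15);(7,9,22);(7,10,24);(7,11,21);(7,12,26);(7,13,29);(7,14,23);
    (7,17,20);(8,10,20);(8,11,28);(8,13,17);(8,14,25);(8,16,21);(8,23,26);
    (9,11,17);(9,12,20);(9,15,26);(9,16,29);(9,19,21);(9,23,28);(9,24,27);
    (10,12,18);(10,13,16);(10,21,25);(10,22,29);(10,27,28);(11,12,29);
    (11,15,24);(11,16,22);(11,18,20);(11,23,25);(12,15,19);(12,22,25);
    (12,23,24);(13,14,26);(13,15,18);(13,20,22);(13,21,24);(13,25,27);
    (14,17,22);(14,18,24);(14,19,29);(14,21,28);(15,16,25);(15,17,28);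
    (15,21,27);(16,18,27);(16,19,23);(16,26,28);(17,18,25);(17,19,26);
    (17,21,23);(18,22,28);(19,22,27);(19,24,28);(20,23,27);(20,24,29);
    (20,25,26);(21,26,29)]);
  (15, 6, [::
    (0,4,21);(0,5,16);(0,6,29);(0,7,28);(0,8,22);(0,9,14);(0,10,27);(0,11,20);
    (0,12,25);(0,13,19);(0,15,17);(0,18,23);(0,24,26);(1,4,13);(1,5,15);
    (1,6,22);(1,7,27);(1,8,12);(1,9,20);(1,10,24);(1,11,23);(1,14,17);(1,16,26);
    (1,18,25);(1,19,29);(1,21,28);(2,4,19);(2,5,12);(2,6,17);(2,7,24);(2,8,23);
    (2,9,28);(2,10,15);(2,11,29);(2,13,18);(2,14,20);(2,16,27);(2,21,25);
    (2,22,26);(3,4,27);(3,5,8);(3,6,14);(3,7,10);(3,9,13);(3,11,26);(3,12,16);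
    (3,15,21);(3,17,23);(3,18,24);(3,19,28);(3,20,25);(3,22,29);(4,8,14);
    (4,9,23);(4,10,18);(4,11,24);(4,12,29);(4,15,26);(4,16,28);(4,17,20);
    (4,22,25);(5,9,24);(5,10,17);(5,11,25);(5,13,29);(5,14,21);(5,18,28);
    (5,19,22);(5,20,26);(5,23,27);(6,8,20);(6,9,16);(6,10,25);(6,11,13);
    (6,12,23);(6,15,28);(6,18,26);(6,19,27);(6,21,24);(7,8,18);(7,9,17);
    (7,11,16);(7,12,20);(7,13,22);(7,14,23);(7,15,25);(7,19,21);(7,26,29);
    (8,13,28);(8,15,16);(8,17,27);(8,19,25);(8,21,26);(8,24,29);(9,12,19);
    (9,15,22);(9,18,21);(9,25,26);(9,27,29);(10,12,21);(10,13,26);(10,14,29);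
    (10,16,22);(10,19,20);(10,23,28);(11,12,28);(11,14,19);(11,15,18);
    (11,17,21);(11,22,27);(12,17,26);(12,18,27);(12,22,24);(13,16,20);
    (13,17,24);(13,21,27);(13,23,25);(14,16,25);(14,18,22);(14,24,27);
    (14,26,28);(15,19,24);(15,20,27);(15,23,29);(16,21,29);(16,23,24);
    (17,22,28);(17,25,29);(18,20,29);(19,23,26);(20,24,28);(25,27,28)]);
  (16, 6, [::
    (0,4,30);(0,5,31);(0,6,15);(0,7,8);(0,9,28);(0,10,16);(0,11,13);(0,12,20);
    (0,14,17);(0,18,24);(0,19,29);(0,21,26);(0,22,25);(0,23,27);(1,4,14);
    (1,5,13);(1,6,12);(1,7,20);(1,8,26);(1,9,15);(1,10,19);(1,11,23);(1,16,31);
    (1,17,21);(1,18,29);(1,22,24);(1,25,27);(1,28,30);(2,4,16);(2,5,14);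
    (2,6,23);(2,7,26);(2,8,20);(2,9,21);(2,10,30);(2,11,24);(2,12,22);(2,13,18);
    (2,15,31);(2,17,29);(2,19,25);(2,27,28);(3,4,22);(3,5,26);(3,6,17);(3,7,10);
    (3,8,21);(3,9,13);(3,11,19);(3,12,18);(3,14,27);(3,15,24);(3,16,23);
    (3,20,30);(3,25,28);(3,29,31);(4,8,28);(4,9,18);(4,10,26);(4,11,27);
    (4,12,19);(4,13,17);(4,15,23);(4,20,24);(4,21,31);(4,25,29);(5,8,19);
    (5,9,29);(5,10,18);(5,11,21);(5,12,28);(5,15,30);(5,16,22);(5,17,25);
    (5,20,27);(5,23,24);(6,8,22);(6,9,31);(6,10,25);(6,11,26);(6,13,28);
    (6,14,18);(6,16,20);(6,19,27);(6,21,24);(6,29,30);(7,9,23);(7,11,28);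
    (7,12,21);(7,13,31);(7,14,30);(7,15,16);(7,17,24);(7,18,25);(7,19,22);
    (7,27,29);(8,12,29);(8,13,16);(8,14,31);(8,15,25);(8,17,30);(8,18,23);
    (8,24,27);(9,12,25);(9,14,24);(9,16,27);(9,17,26);(9,19,20);(9,22,30);
    (10,12,24);(10,13,22);(10,14,28);(10,15,21);(10,17,20);(10,23,29);
    (10,27,31);(11,12,31);(11,14,16);(11,15,17);(11,18,22);(11,20,29);
    (11,25,30);(12,16,30);(12,17,27);(12,23,26);(13,19,26);(13,20,25);
    (13,21,27);(13,23,30);(13,24,29);(14,19,23);(14,20,26);(14,21,25);
    (14,22,29);(15,18,20);(15,19,28);(15,22,27);(15,26,29);(16,21,29);
    (16,24,28);(16,25,26);(17,22,31);(17,23,28);(18,21,28);(18,26,31);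
    (18,27,30);(19,21,30);(19,24,31);(20,28,31);(22,26,28);(23,25,31);
    (24,26,30)])].

Lemma base_designsP h b : (h, b) \in [seq d.1 | d <- base_designs] ->
  gdd24_exists h b.
Proof.
have /allP chk : all (fun d => gdd24_cert d.1.1 d.1.2 d.2) base_designs.
  by vm_compute.
by case/mapP=> [[[h' b'] ts]] /chk /= ok [-> ->]; apply: gdd24_exists_cert ok.
Qed.

(** * Recursive existence of the admissible designs *)

(** The congruence makes the number of triples integral, and [2 * b <= h] leaves room for the
    quadruples. A design has [('C(2 * h, 2) + 2 * h - 7 * b) / 3] edges including groups, so [n]
    near a third of ['C(2 * h, 2)] asks for [7 * b] up to about [2 * h]; 20 is a margin for
    rounding. *)
Definition gdd24_ok h b :=
  [&& b %% 3 == (h %% 3 == 2), 2 * b <= h & 7 * b <= 2 * h + 20].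

Lemma gdd24_exists_step_mod3 t s e lo K b4 j b :
  odd t -> s <= t -> e <= 2 ->
  (forall k, k <= K -> gdd24_exists (t + e) (lo + 3 * k)) ->
  (e == 1) ==> (2 * (lo + 3 * K) < t + e) -> (e == 2) ==> (0 < lo) ->
  gdd24_exists (s + e) b4 -> j <= 3 * K ->
  3 * lo + 3 * j + b4 = b + 3 * (e == 2) ->
  gdd24_exists (3 * t + s + e) b.
Proof.
case: t => // n t_odd st e2 Flo e1 e2lo F4 jK sb.
(* Greedy splitting of [j] into three summands of at most [K]. *)
pose k0 := minn j K; pose k1 := minn (j - k0) K; pose k2 := j - k0 - k1.
pose b_ (i : 'I_4) := if i == ord_max then b4 else lo + 3 * nth 0 [:: k0; k1; k2] i.
have kK (i : 'I_4) : nth 0 [:: k0; k1; k2] i <= K.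
  by case: i => [[|[|[|[|//]]]] i4] /=; rewrite /k2 /k1 /k0; lia.
apply: (gdd24_exists_step t_odd st (b_ := b_)) => //.
- move=> i i3; rewrite /b_ ifF; last by apply/eqP => im; rewrite im in i3.
  exact: Flo.
- move=> i i3; rewrite /b_ ifF; last by apply/eqP => im; rewrite im in i3.
  move: e1 e2lo (kK i); set k := nth _ _ _; clear -e2.
  by case: e e2 => [|[|[|//]]] //= _; lia.
by rewrite /b_ !big_ord_recl big_ord0 -!val_eqE /=; rewrite /k2 /k1 /k0; lia.
Qed.

(* The three groups of size 2 t, completed by the 2 e points at infinity, are
   filled with lo + 3 k quadruples (k <= K), the last one with b4. *)
Definition step_ok h b e t b4 :=
  let lo := if (e == 2) && ((t + e) %% 3 != 2) then 3 else ((t + e) %% 3 == 2) : nat in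
  let K := (minn ((t + e - (e == 1)) %/ 2) ((2 * (t + e) + 20) %/ 7) - lo) %/ 3 in
  let s := h - e - 3 * t in
  [&& odd t, 3 * t + e <= h, s <= t, t + e < h, e <= 2,
      gdd24_ok (t + e) (lo + 3 * K), (e == 1) ==> (2 * (lo + 3 * K) < t + e),
      (e == 2) ==> (0 < lo), gdd24_ok (s + e) b4,
      b4 + 3 * lo <= b + 3 * (e == 2)
    & (b + 3 * (e == 2) - b4 - 3 * lo) %/ 3 <= 3 * K].

Lemma gdd24_exists_step_ok h b e t b4 : gdd24_ok h b -> step_ok h b e t b4 ->
  (forall h' b', h' < h -> gdd24_ok h' b' -> gdd24_exists h' b') ->
  gdd24_exists h b.
Proof.
rewrite /step_ok; set lo := if _ then _ else _; set K := _ %/ 3; set s := h - e - _.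
set j := _ %/ 3; move=> okb.
case/and5P=> t_odd th st teh; case/and5P=> e2 okK e1 e2lo.
case/and3P=> ok4 b4b jK IH.
have jE : j = (b + 3 * (e == 2) - b4 - 3 * lo) %/ 3 by [].
have hE : h = 3 * t + s + e by rewrite /s; clear -th; lia.
clearbody lo K s j; rewrite hE.
apply: (@gdd24_exists_step_mod3 t s e lo K b4 j b) => //.
- move=> k kK; apply: IH => //; move: okK; rewrite /gdd24_ok => /and3P[/eqP l0 l1 l2].
  clear -l0 l1 l2 kK; apply/and3P; split; [rewrite -l0|..]; lia.
- by apply: IH => //; move: t_odd; case: (t) hE => // t' ->; lia.
(* The division defining [j] is exact: [3 * t] vanishes mod 3, so [b] and [b4] satisfy the same
   congruence. *)
have : (b + 3 * (e == 2) - b4 - 3 * lo) %% 3 = 0.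
  move: okb ok4; rewrite /gdd24_ok => /and3P[/eqP h0 _ _] /and3P[/eqP h1 _ _].
  have e3 : h %% 3 = (s + e) %% 3 by rewrite hE; lia.
  by move: h0 h1; rewrite e3; clear; lia.
by clear -jE b4b; lia.
Qed.

(* Unlike [has], stops at the first success under call-by-value evaluation. *)
Fixpoint lazy_has (T : Type) (p : T -> bool) (s : seq T) :=
  if s is x :: s' then if p x then true else lazy_has p s' else false.

Lemma lazy_hasE (T : Type) (p : T -> bool) s : lazy_has p s = has p s.
Proof. by elim: s => //= x s ->; case: (p x). Qed.

(** The test before the innermost search expresses [s <= t], and [step_ok] forces [b4 <= b + 3], so
    the finite ranges lose nothing. Inadmissible pairs count as successes. *)
Definition step_search h b :=
  if gdd24_ok h b then
    if (h, b) \in [seq d.1 | d <- base_designs] then true else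
    lazy_has (fun e => lazy_has (fun t =>
      if [&& odd t, 3 * t + e <= h & h <= 4 * t + e] then
        lazy_has (step_ok h b e t) (iota 0 (b + 4)) else false)
      (iota 1 (h %/ 3))) (iota 0 3)
  else true.

Lemma gdd24_exists_ok h b : gdd24_ok h b -> gdd24_exists h b.
Proof.
elim/ltn_ind: h b => h IH b okb.
have IH' h' b' : h' < h -> gdd24_ok h' b' -> gdd24_exists h' b' by move=> lt; apply: IH.
have [h0|h_gt0] := posnP h.
  have -> : b = 0 by move: okb; rewrite /gdd24_ok h0; lia.
  exists unit, set0, (fun=> 0), (fun x _ => x).
  by rewrite cards0 h0; split=> //; apply: gdd24_empty.
(* From 172 = 4 * 43 on, [h <= 3 * t + 43] forces [t >= 43], hence [s <= t] below. *)
have [hs|hl] := ltnP h 172.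
  have /allP chk : all (fun h => all (step_search h) (iota 0 60)) (iota 1 171).
    by vm_compute.
  have hin : h \in iota 1 171 by rewrite mem_iota; lia.
  have bin : b \in iota 0 60.
    by rewrite mem_iota; move: okb => /and3P[_ _]; lia.
  have := allP (chk _ hin) _ bin; rewrite /step_search okb.
  case: ifP => [inb _|_]; first exact: base_designsP.
  rewrite !lazy_hasE => /hasP[e _]; rewrite lazy_hasE => /hasP[t _].
  case: ifP => // _; rewrite lazy_hasE => /hasP[b4 _ st].
  exact: gdd24_exists_step_ok st IH'.
(* For such t the multiple 3 K of 3 is close enough to (2 t + 20) / 7 that three
   fillings of the large groups and one of the small group reach b. *)
pose good t := [&& odd t, t %% 3 != 2 & (2 * t + 20) %% 21 <= 13].
have [t [t_odd t3 t13 tb]] : exists t, [/\ odd t, t %% 3 != 2, (2 * t + 20) %% 21 <= 13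
    & (3 * t + 14 <= h) && (h <= 3 * t + 43)].
  (* The conditions depend on [t] mod 42 only, and ten consecutive residues always contain a good
     one. Going down at most 9 from [(h - 14) %/ 3] yields the bound 43. *)
  have /allP chk : all (fun r => has (fun d => good ((r + 42 - d) %% 42)) (iota 0 10))
    (iota 0 42) by vm_compute.
  pose q := (h - 14) %/ 3.
  have /hasP[d] : has (fun d => good ((q %% 42 + 42 - d) %% 42)) (iota 0 10).
    by apply: chk; rewrite mem_iota; lia.
  rewrite mem_iota => d10 /and3P[g1 g2 g3].
  by exists (q - d); split; rewrite /q in g1 g2 g3 *; lia.
pose s := h - 3 * t; pose K := (2 * t + 20) %/ 21.
(* The largest number congruent to [b] mod 3 with [7 * B4 <= 2 * s + 20]; then [14 <= s] ensures
   [2 * B4 <= s]. *)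
pose B4 := 3 * ((2 * s + 20 - 7 * (b %% 3)) %/ 21) + b %% 3.
have [b3 b2 b7] := and3P okb.
have h3 : h %% 3 = s %% 3 by rewrite /s; lia.
pose b4 := if b <= B4 then b else B4.
have hE : h = 3 * t + s + 0 by rewrite /s; lia.
rewrite hE; apply: (@gdd24_exists_step_mod3 t s 0 0 K b4 ((b - b4) %/ 3)) => //.
- by rewrite /s; lia.
- move=> k kK; apply: IH'; first by lia.
  by rewrite /gdd24_ok; apply/and3P; split; rewrite /K in kK; lia.
- apply: IH'; first by rewrite /s; lia.
  move: b3; rewrite /gdd24_ok addn0 h3 => b3; apply/and3P.
  by rewrite /b4; case: (leqP b B4) => bB; split; rewrite /B4 /s in bB *; lia.
(* Together 7 (9 K + B4) >= 3 (2 t + 7) + 2 s = 2 h + 21, which exceeds [7 * b]. *)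
- have K7 : 2 * t + 7 <= 21 * K by rewrite /K; clear -t13; lia.
  have B7 : 2 * s <= 7 * B4 by rewrite /B4; clear; lia.
  rewrite hE in b7; rewrite /b4; clearbody K s B4; clear -K7 B7 b7.
  by case: (leqP b B4) => bB; lia.
- rewrite /= /b4; case: (leqP b B4); rewrite /B4; set X := (_ %/ 21) => bB; clear -bB; lia.
Qed.

(** * Packings by triples and quadruples *)

Section LinearSeq.
Variable V : finType.
Implicit Types (es : seq {set V}) (e : {set V}).

Definition linear_seq es := forall x y : V, x != y ->
  count (fun e => (x \in e) && (y \in e)) es <= 1.

Lemma linear_total_degree_seq es : linear_seq es -> set0 \notin es ->
  linear_total_degree #|V| (size es) (\sum_(e <- es) #|e|).
Proof.
move=> les e0; have pE := perm_eq_seq_mset es.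
have E0 e : e \in seq_mset es -> e != set0.
  move=> ein; apply: contraNneq e0 => <-.
  by rewrite -(perm_mem pE).
exists (Hypergraph E0); split=> //=.
- by move=> x y xy; rewrite (permP pE); apply: les.
- exact: perm_size.
exact: perm_big.
Qed.

Lemma count_le1 (p : pred {set V}) es : uniq es ->
  {in es &, forall e e', p e -> p e' -> e = e'} -> count p es <= 1.
Proof.
move=> ues pu; rewrite -size_filter.
have uf : uniq (filter p es) by apply: filter_uniq.
case E : (filter p es) uf => [|e [|e' s]] //= /andP[+ _].
rewrite inE negb_or => /andP[/eqP ee' _]; exfalso; apply: ee'.
have : (e \in filter p es) && (e' \in filter p es) by rewrite E !inE !eqxx orbT.
by rewrite !mem_filter => /andP[/andP[pe ?] /andP[pe' ?]]; apply: pu.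
Qed.

(* Every pair contained in no member of [es] may be added, and there are at
   least 'C(|V|, 2) - \sum_e 'C(|e|, 2) of them. *)
Lemma linear_seq_add_pairs es p : linear_seq es ->
  \sum_(e <- es) 'C(#|e|, 2) + p <= 'C(#|V|, 2) ->
  exists2 ps, linear_seq (es ++ ps) & size ps = p /\ all (fun e => #|e| == 2) ps.
Proof.
move=> les hp.
pose U := [set e : {set V} | (#|e| == 2) && all (fun e' => ~~ (e \subset e')) es].
have cU : p <= #|U|.
  pose D := [set e : {set V} | #|e| == 2].
  have cD : #|D| = 'C(#|V|, 2) by rewrite -card_draws; apply: eq_card => e; rewrite !inE.
  have : #|D| <= #|U| + \sum_(e <- es) 'C(#|e|, 2).
    (* A pair outside [U] lies in some member of [es]: union bound. *)
    have DU : #|D :\: U| <= \sum_(e <- es) 'C(#|e|, 2).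
      have -> : D :\: U = [set e in D | has (fun e' : {set V} => e \subset e') es].
        apply/setP => e; rewrite !inE; case: (#|e| == 2); rewrite ?andbF //= andbT.
        by rewrite -has_predC; apply: eq_has => e' /=; rewrite negbK.
      elim: (es) => [|e' es' IH].
        by rewrite big_nil leqn0 cards_eq0; apply/eqP/setP => e; rewrite !inE andbF.
      rewrite big_cons -cards_draws; apply: leq_trans (leq_add (leqnn _) IH).
      apply: leq_trans (leq_card_setU _ _); apply: subset_leq_card.
      apply/subsetP => e; rewrite !inE /= => /andP[-> /orP[->|->]] //=.
      by rewrite orbT.
    by rewrite -(cardsID U D) leq_add // subset_leq_card // subsetIr.
  by rewrite cD; move: hp; lia.
exists (take p (enum U)); last first.
  split; first by rewrite size_take -cardE; case: ltnP => //; lia.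
  by apply/allP => e /mem_take; rewrite mem_enum inE => /andP[].
have uU : uniq (take p (enum U)) by rewrite take_uniq // enum_uniq.
have UP e x y : x != y -> e \in take p (enum U) -> (x \in e) && (y \in e) ->
    e = [set x; y] /\ all (fun e' => ~~ (e \subset e')) es.
  move=> xy /mem_take; rewrite mem_enum inE => /andP[/eqP e2 ea] /andP[xe ye].
  split=> //; apply/esym/eqP; rewrite eqEcard subUset !sub1set xe ye /=.
  by rewrite cards2 xy e2.
move=> x y xy; rewrite count_cat.
have [c0|] := posnP (count (fun e => (x \in e) && (y \in e)) es).
  rewrite c0 add0n; apply: count_le1 => // e e' eU eU' xe xe'.
  by have [-> _] := UP _ _ _ xy eU xe; have [-> _] := UP _ _ _ xy eU' xe'.
rewrite -has_count => /hasP[e' e'es /andP[xe' ye']].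
suff -> : count (fun e => (x \in e) && (y \in e)) (take p (enum U)) = 0.
  by rewrite addn0; apply: les.
apply/eqP; rewrite -leqn0 leqNgt -has_count; apply/hasPn => e eU.
apply/negP => xye; have [eE /allP/(_ _ e'es)] := UP _ _ _ xy eU xye.
by rewrite eE subUset !sub1set xe' ye'.
Qed.

End LinearSeq.

(** Edges of size 2 are left out, because [linear_seq_add_pairs] supplies any number of them that
    the uncovered pairs allow. *)
Definition packing m t q := exists (V : finType) (T Q : seq {set V}),
  [/\ #|V| = m, linear_seq (T ++ Q), (size T = t) * (size Q = q)
    & all (fun e : {set V} => #|e| == 3) T /\ all (fun e : {set V} => #|e| == 4) Q].

Lemma sum_all_const (I : eqType) (s : seq I) (P : pred I) (F : I -> nat) c :
  all P s -> (forall i, P i -> F i = c) -> \sum_(i <- s) F i = size s * c.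
Proof.
move=> /allP Ps PF; rewrite big_seq (eq_bigr (fun=> c)) => [|i /Ps/PF //].
by rewrite -big_seq big_const_seq count_predT iter_addn_0 mulnC.
Qed.

Lemma packing_total_degree m t q p : packing m t q ->
  3 * t + 6 * q + p <= 'C(m, 2) ->
  linear_total_degree m (t + q + p) (3 * t + 4 * q + 2 * p).
Proof.
move=> [V [T [Q [<- lin [sT sQ] [T3 Q4]]]]] hp.
have sumT F c : (forall e : {set V}, #|e| == 3 -> F e = c) -> \sum_(e <- T) F e = t * c.
  by move=> h; rewrite -sT; apply: sum_all_const T3 h.
have sumQ F c : (forall e : {set V}, #|e| == 4 -> F e = c) -> \sum_(e <- Q) F e = q * c.
  by move=> h; rewrite -sQ; apply: sum_all_const Q4 h.
have [|ps linp [sp p2]] := linear_seq_add_pairs (p := p) lin.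
  rewrite big_cat /= (sumT _ 3) => [|e /eqP -> //]; rewrite (sumQ _ 6) => [|e /eqP -> //].
  by apply: leq_trans hp; lia.
have -> : t + q + p = size ((T ++ Q) ++ ps) by rewrite !size_cat sT sQ sp.
have -> : 3 * t + 4 * q + 2 * p = \sum_(e <- (T ++ Q) ++ ps) #|e|.
  rewrite !big_cat /= (sumT _ 3) => [|e /eqP -> //]; rewrite (sumQ _ 4) => [|e /eqP -> //].
  by rewrite (sum_all_const (c := 2) p2) => [|e /eqP -> //]; rewrite sp; lia.
apply: linear_total_degree_seq => //.
rewrite !mem_cat !negb_or -andbA; apply/and3P; split; apply/negP.
- by move=> /(allP T3); rewrite cards0.
- by move=> /(allP Q4); rewrite cards0.
- by move=> /(allP p2); rewrite cards0.
Qed.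

Lemma linear_seq_sub (V : finType) (es es' : seq {set V}) :
  (forall p, count p es' <= count p es) -> linear_seq es -> linear_seq es'.
Proof. by move=> sub les x y xy; apply: leq_trans (sub _) (les x y xy). Qed.

Lemma packing_le m t q t' q' : t' <= t -> q' <= q -> packing m t q -> packing m t' q'.
Proof.
move=> tt qq [V [T [Q [cV lin [sT sQ] [T3 Q4]]]]].
exists V, (take t' T), (take q' Q); split=> //.
- apply: linear_seq_sub lin => p.
  have ctake k (s : seq {set V}) : count p (take k s) <= count p s.
    by rewrite -[in leqRHS](cat_take_drop k s) count_cat leq_addr.
  by rewrite !count_cat leq_add.
- by rewrite !size_takel // ?sT ?sQ.
by split; apply/allP => e /mem_take; [apply: (allP T3)|apply: (allP Q4)].
Qed.

(** Removing a point from a quadruple leaves a triple and frees three pairs. *)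
Lemma packing_quad_triple m t q : packing m t q.+1 -> packing m t.+1 q.
Proof.
move=> [V [T [[|e Q] [cV lin [sT sQ] [T3 Q4]]]]] //.
have [/eqP e4 Q4'] : #|e| == 4 /\ all (fun e : {set V} => #|e| == 4) Q by apply/andP.
have /card_gt0P[x xe] : 0 < #|e| by rewrite e4.
exists V, ((e :\ x) :: T), Q; split=> //=; [|by case: sQ => <-; rewrite sT|]; last first.
  by split=> //; apply/andP; split=> //; have := cardsD1 x e; rewrite xe e4; lia.
move=> y z yz; have := lin y z yz; rewrite /= !count_cat /= !inE.
set a := count _ T; set b := count _ Q.
by case: (y \in e); case: (z \in e); case: (y != x); case: (z != x) => /=; lia.
Qed.

(** * Packings obtained from designs *)

Section DesignPackings.
Variables (V : finType) (g : V -> nat) (f : V -> V -> V) (h b : nat).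
Hypotheses (cV : #|V| = 2 * h) (G : gdd24 [set: V] b g f).

Let op x y : g x != g y ->
  [/\ f y x = f x y, g (f x y) != g x & f x (f x y) = y].
Proof. by move=> gxy; case: G => o _ _; have [] := o x y (in_setT x) (in_setT y) gxy. Qed.

Let neq_g x y : g x != g y -> x != y.
Proof. by apply: contra_neq => ->. Qed.

Definition design_triples : {set {set V}} :=
  [set [set p.1; p.2; f p.1 p.2] | p in [set p : V * V | g p.1 != g p.2]].

(** The laws of [f] are symmetric in the three points of a triple: [f] sends any two of them to the
    third. *)
Lemma design_triple_pair e x y : e \in design_triples -> x \in e -> y \in e ->
  x != y -> g x != g y /\ e = [set x; y; f x y].
Proof.
move=> /imsetP[[u v]]; rewrite inE /= => guv ->.
have [vu fu fK] := op guv; have gvu : g v != g u by rewrite eq_sym.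
have [_ fv fK'] := op gvu; rewrite vu in fv fK'.
rewrite eq_sym in fu; have [fC _ _] := op fu; rewrite fK in fC.
rewrite eq_sym in fv; have [fC' _ _] := op fv; rewrite fK' in fC'.
have perm3 (a c d : V) : [set a; c; d] = [set c; a; d] /\ [set a; c; d] = [set a; d; c].
  by split; apply/setP => z; rewrite !inE; case: (z == a); case: (z == c); case: (z == d).
have gfu : g (f u v) != g u by rewrite eq_sym.
have gfv : g (f u v) != g v by rewrite eq_sym.
set w := f u v in fu fv fC fC' gfu gfv fK fK' *.
have [p1 p2] := perm3 u v w.
rewrite !inE -!orbA.
move=> /or3P[]/eqP-> /or3P[]/eqP->; rewrite ?eqxx // => _; split=> //.
- by rewrite fK p2.
- by rewrite vu p1.
- by rewrite fK' p1 (perm3 v u w).2.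
- by rewrite fC p2 (perm3 u w v).1.
- by rewrite fC' p1 (perm3 v u w).2 (perm3 v w u).1.
Qed.

Lemma design_triple_card e : e \in design_triples -> #|e| = 3.
Proof.
move=> /imsetP[[u v]]; rewrite inE /= => guv ->.
have [vu fu fK] := op guv; have gvu : g v != g u by rewrite eq_sym.
have [_ fv _] := op gvu; rewrite vu in fv.
rewrite setUC cardsU1 cards2 !inE.
by rewrite neq_g // (negbTE (neq_g fu)) (negbTE (neq_g fv)).
Qed.

(** Ordered pairs across groups number 4 h^2 - 4 h - 8 b, as each of the [4 * b] points in
    quadruples has two extra companions; a triple accounts for six ordered pairs. *)
Lemma card_design_triples : 2 * h * h <= 3 * #|design_triples| + 2 * h + 4 * b.
Proof.
pose P := [set p : V * V | g p.1 != g p.2].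
have : #|P| <= 6 * #|design_triples|.
  rewrite -sum1_card (partition_big (fun p => [set p.1; p.2; f p.1 p.2])
    (mem design_triples)) /=; last by move=> p pP; apply: imset_f.
  rewrite mulnC -sum_nat_const; apply: leq_sum => e eT.
  have -> : 6 = #|[set p in setX e e | p.1 != p.2]|.
    have := cardsID [set p | p.1 == p.2] (setX e e); rewrite cardsX (design_triple_card eT).
    have -> : setX e e :&: [set p | p.1 == p.2] = [set (x, x) | x in e].
      apply/setP => [[x y]]; rewrite !inE /=; apply/idP/imsetP => [|[z ze [-> ->]]].
        by move=> /andP[/andP[xe _] /eqP <-]; exists x.
      by rewrite ze eqxx.
    rewrite card_imset => [|x y [] //]; rewrite (design_triple_card eT).
    rewrite (_ : setX e e :\: _ = [set p in setX e e | p.1 != p.2]); first by lia.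
    by apply/setP => p; rewrite !inE andbC.
  rewrite sum1_card; apply: subset_leq_card; apply/subsetP => [[x y]].
  rewrite !inE /= => /andP[gxy /eqP <-]; rewrite !inE !eqxx !orbT /=.
  by move: gxy; rewrite inE; apply: neq_g.
have cP : #|P| + \sum_x #|group_of [set: V] g x| = 2 * h * (2 * h).
  rewrite -cV -card_prod -(cardC P); congr (_ + _); rewrite -[RHS]sum1_card.
  under eq_bigr do rewrite -sum1_card.
  by rewrite pair_big_dep /=; apply: eq_bigl => [[x y]]; rewrite !inE /= negbK eq_sym.
have : \sum_x #|group_of [set: V] g x| = 2 * (2 * h) + 2 * (4 * b).
  case: G => _ sz <-; rewrite -cV -[X in _ + 2 * X]sum1_card big_distrr /=.
  rewrite [X in _ + X]big_mkcond /=.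
  rewrite mulnC -sum_nat_const -big_split /=; apply: eq_bigr => x _.
  rewrite !inE /=; have := sz x (in_setT x); rewrite !inE.
  by move=> /orP[/eqP->|/eqP->].
by lia.
Qed.

Definition design_quads : {set {set V}} :=
  [set group_of [set: V] g x | x in [set x | #|group_of [set: V] g x| == 4]].

Lemma design_quad_mem e x : e \in design_quads -> x \in e ->
  e = group_of [set: V] g x /\ #|e| = 4.
Proof.
move=> /imsetP[y]; rewrite inE => /eqP y4 ->; rewrite !inE /= => /eqP xy; split=> //.
by apply/setP => z; rewrite !inE xy.
Qed.

Lemma card_design_quads : b <= #|design_quads|.
Proof.
suff : 4 * b <= 4 * #|design_quads| by lia.
case: G => _ _ <-; rewrite -sum1_card.
rewrite (partition_big (group_of [set: V] g) (mem design_quads)) /=; last first.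
  by move=> x; rewrite !inE /= => x4; apply: imset_f; rewrite inE.
rewrite mulnC -sum_nat_const; apply: leq_sum => e eQ; rewrite sum1_card.
have [x xe] : exists x, x \in e.
  by move/imsetP: eQ => [x _ ->]; exists x; rewrite !inE eqxx.
rewrite -(design_quad_mem eQ xe).2; apply: subset_leq_card; apply/subsetP => y.
by rewrite unfold_in => /andP[_ /eqP <-]; rewrite !inE eqxx.
Qed.

Lemma design_packing t : 3 * t + 2 * h + 4 * b <= 2 * h * h -> packing (2 * h) t b.
Proof.
move=> tb; apply: (@packing_le _ #|design_triples| #|design_quads|).
- by have := card_design_triples; lia.
- exact: card_design_quads.
exists V, (enum design_triples), (enum design_quads); split=> //.
- move=> x y xy; rewrite count_cat.
  have cQ : count (fun e : {set V} => (x \in e) && (y \in e)) (enum design_quads)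
      <= (g x == g y).
    case: eqP => gxy; last first.
      rewrite leqNgt -has_count; apply/hasPn => e; rewrite mem_enum => eQ.
      apply/negP => /andP[xe]; rewrite (design_quad_mem eQ xe).1 !inE /= => /eqP gyx.
      by rewrite gyx in gxy.
    apply: count_le1; first exact: enum_uniq.
    move=> e e'; rewrite !mem_enum => eQ eQ' /andP[xe _] /andP[xe' _].
    by rewrite (design_quad_mem eQ xe).1 (design_quad_mem eQ' xe').1.
  have cT : count (fun e : {set V} => (x \in e) && (y \in e)) (enum design_triples)
      <= (g x != g y).
    case: eqP => gxy /=.
      rewrite leqNgt -has_count; apply/hasPn => e; rewrite mem_enum => eT.
      by apply/negP => /andP[xe ye]; have [/eqP] := design_triple_pair eT xe ye xy.
    apply: count_le1; first exact: enum_uniq.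
    move=> e e'; rewrite !mem_enum => eT eT' /andP[xe ye] /andP[xe' ye'].
    by have [_ ->] := design_triple_pair eT xe ye xy;
       have [_ ->] := design_triple_pair eT' xe' ye' xy.
  by move: cQ cT; case: eqP => /= _; lia.
- by rewrite -!cardE.
split; apply/allP => e; rewrite mem_enum.
  by move=> /design_triple_card ->.
by move=> /imsetP[x]; rewrite inE => x4 ->.
Qed.

(** A fixed-point-free involution inside the groups: positions 0 and 1, then 2 and 3, of the
    enumeration are swapped. Group sizes are even, so no index falls off the end. *)
Definition mate x := let s := enum (group_of [set: V] g x) in
  let i := index x s in nth x s (if odd i then i.-1 else i.+1).

Lemma mateP x : [/\ g (mate x) = g x, mate x != x & mate (mate x) = x].
Proof.
rewrite /mate; set s := enum _; set i := index x s; set j := if _ then _ else _.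
have xs : x \in s by rewrite mem_enum !inE eqxx.
have ix : i < size s by rewrite index_mem.
have szs : size s \in [:: 2; 4] by rewrite -cardE; case: G => _ sz _; apply: sz.
have jx : j < size s by rewrite /j; move: szs; rewrite !inE; case: ifP => ?; lia.
have ij : j != i by rewrite /j; case: ifP => ?; lia.
have us : uniq s by apply: enum_uniq.
have : nth x s j \in s by rewrite mem_nth.
rewrite mem_enum !inE /= => /eqP gj; split=> //.
  by apply: contra ij => /eqP e; rewrite -(nth_uniq x jx ix us) e /i nth_index.
rewrite (_ : group_of [set: V] g (nth x s j) = group_of [set: V] g x); last first.
  by apply/setP => z; rewrite !inE gj.
rewrite -/s index_uniq // (_ : (if odd j then j.-1 else j.+1) = i).
  by rewrite (set_nth_default x) // nth_index.
by rewrite /j; clearbody i; clear; case: (boolP (odd i)) => io; case: ifP => jo; lia.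
Qed.

Definition mate_pairs : {set {set V}} := [set [set x; mate x] | x in [set: V]].

Lemma mate_pair_mem e x : e \in mate_pairs -> x \in e -> e = [set x; mate x].
Proof.
move=> /imsetP[y _ ->]; rewrite !inE => /orP[/eqP->//|/eqP->].
by have [_ _ ->] := mateP y; rewrite setUC.
Qed.

Lemma mate_pair_card e : e \in mate_pairs -> #|e| = 2.
Proof. by move=> /imsetP[x _ ->]; rewrite cards2 eq_sym; have [_ -> _] := mateP x. Qed.

Lemma card_mate_pairs : h <= #|mate_pairs|.
Proof.
suff : 2 * h <= 2 * #|mate_pairs| by lia.
rewrite -cV -cardsT -[leqLHS]sum1_card.
rewrite (partition_big (fun x => [set x; mate x]) (mem mate_pairs)) /=; last first.
  by move=> x _; apply: imset_f.
rewrite mulnC -sum_nat_const; apply: leq_sum => e eM; rewrite sum1_card.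
rewrite -(mate_pair_card eM); apply: subset_leq_card; apply/subsetP => x.
by rewrite unfold_in => /andP[_ /eqP <-]; rewrite !inE eqxx.
Qed.

(** [None] is a new point at infinity, and [c] says whether the edge receives it. *)
Definition lift_edge c (e : {set V}) : {set option V} :=
  [set o | if o is Some x then x \in e else c].

Lemma card_lift_edge c e : #|lift_edge c e| = c + #|e|.
Proof.
have -> : lift_edge c e = (if c then [set None] else set0) :|: [set Some x | x in e].
  apply/setP => [[x|]]; rewrite !inE.
    by rewrite (mem_imset _ _ (@Some_inj _)); case: c; rewrite !inE.
  by case: c; rewrite !inE //; apply/esym/imsetP => -[].
have -> := cardsU (if c then [set None] else set0) [set Some x | x in e].
rewrite (_ : _ :&: _ = set0) ?cards0 ?subn0; last first.
  apply/setP => [[x|]]; rewrite !inE; case: c; rewrite !inE //.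
  by apply/imsetP => -[].
by rewrite card_imset //; [case: c; rewrite ?cards1 ?cards0 | apply: Some_inj].
Qed.

(** Each mate pair becomes a triple through infinity. A quadruple has two of its six pairs covered
    in this way; the other four account for the term [4 * b]. *)
Lemma design_packing_odd t : 3 * t + 4 * b <= 2 * h * h + h -> packing (2 * h).+1 t 0.
Proof.
move=> tb; apply: (@packing_le _ (#|design_triples| + #|mate_pairs|) 0) => //.
  by have := card_design_triples; have := card_mate_pairs; lia.
exists (option V), (map (lift_edge false) (enum design_triples) ++
  map (lift_edge true) (enum mate_pairs)), [::]; split.
- by rewrite card_option cV.
- rewrite cats0 => o o' oo; rewrite count_cat !count_map.
  have cM : count (preim (lift_edge true) (fun e => (o \in e) && (o' \in e)))
      (enum mate_pairs)
      <= (if o is Some x then if o' is Some y then g x == g y : nat else 1 else 1).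
    case: o o' oo => [x|] [y|] // xy.
    + have {}xy : x != y by apply: contra xy => /eqP->.
      case: eqP => gxy; last first.
        rewrite leqNgt -has_count; apply/hasPn => e; rewrite mem_enum => eM.
        apply/negP; rewrite /= !inE => /andP[xe]; rewrite (mate_pair_mem eM xe) !inE.
        have [gm _ _] := mateP x; rewrite eq_sym (negbTE xy) /= => /eqP yE.
        by rewrite yE gm in gxy.
      apply: count_le1; first exact: enum_uniq.
      move=> e e'; rewrite !mem_enum => eM eM' /=; rewrite !inE => /andP[xe _] /andP[xe' _].
      by rewrite (mate_pair_mem eM xe) (mate_pair_mem eM' xe').
    + apply: count_le1; first exact: enum_uniq.
      move=> e e'; rewrite !mem_enum => eM eM' /=; rewrite !inE => /andP[xe _] /andP[xe' _].
      by rewrite (mate_pair_mem eM xe) (mate_pair_mem eM' xe').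
    + apply: count_le1; first exact: enum_uniq.
      move=> e e'; rewrite !mem_enum => eM eM' /=; rewrite !inE => ye ye'.
      by rewrite (mate_pair_mem eM ye) (mate_pair_mem eM' ye').
  have cT : count (preim (lift_edge false) (fun e => (o \in e) && (o' \in e)))
      (enum design_triples)
      <= (if o is Some x then if o' is Some y then g x != g y : nat else 0 else 0).
    case: o o' oo {cM} => [x|] [y|] // xy.
    + have {}xy : x != y by apply: contra xy => /eqP->.
      case: eqP => gxy /=.
        rewrite leqNgt -has_count; apply/hasPn => e; rewrite mem_enum => eT.
        apply/negP; rewrite /= !inE => /andP[xe ye].
        by have [/eqP] := design_triple_pair eT xe ye xy.
      apply: count_le1; first exact: enum_uniq.
      move=> e e'; rewrite !mem_enum => eT eT' /=; rewrite !inE => /andP[xe ye] /andP[xe' ye'].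
      by have [_ ->] := design_triple_pair eT xe ye xy;
         have [_ ->] := design_triple_pair eT' xe' ye' xy.
    + rewrite leqNgt -has_count; apply/hasPn => e _ /=; by rewrite !inE andbF.
    + rewrite leqNgt -has_count; apply/hasPn => e _ /=; by rewrite !inE.
  by move: cT cM; case: (o) => [x|]; case: (o') => [y|]; try case: eqP => /= _; lia.
- by rewrite size_cat !size_map -!cardE.
split=> //; rewrite all_cat; apply/andP; split; apply/allP => e' /mapP[e + ->].
  by rewrite mem_enum card_lift_edge => /design_triple_card ->.
by rewrite mem_enum card_lift_edge => /mate_pair_card ->.
Qed.

End DesignPackings.

Lemma packing_even h b t : gdd24_ok h b -> 3 * t + 2 * h + 4 * b <= 2 * h * h ->
  packing (2 * h) t b.
Proof.
move=> okb; have cA : #|[set: 'I_(2 * h)]| = 2 * h by rewrite cardsT card_ord.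
have [|g [f [G _ _]]] := gdd24_on (gdd24_exists_ok okb) cA (sub0set _).
  by rewrite cards0.
by apply: (design_packing _ G); rewrite card_ord.
Qed.

Lemma packing_odd h b t : gdd24_ok h b -> 3 * t + 4 * b <= 2 * h * h + h ->
  packing (2 * h).+1 t 0.
Proof.
move=> okb; have cA : #|[set: 'I_(2 * h)]| = 2 * h by rewrite cardsT card_ord.
have [|g [f [G _ _]]] := gdd24_on (gdd24_exists_ok okb) cA (sub0set _).
  by rewrite cards0.
by apply: (design_packing_odd _ G); rewrite card_ord.
Qed.

(** * Upper bounds *)

Section UpperBounds.
Variables (V : finType) (es : seq {set V}).
Hypothesis les : linear_seq es.
Local Notation m := #|V|.
Local Notation n := (size es).
Local Notation D := (\sum_(e <- es) #|e|).

(** By linearity [nbrs x] counts the vertices sharing an edge with [x]. An edge of odd size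
    contributes an even number to it, so its parity is that of [evens x], the number of even edges
    at [x]. *)
Let nbrs x := \sum_(e <- es) (x \in e) * #|e|.-1.
Let evens x := \sum_(e <- es) (x \in e) * ~~ odd #|e|.

Let nbrs_le x : nbrs x <= m.-1.
Proof.
have -> : nbrs x = \sum_(y | y != x) count (fun e : {set V} => (x \in e) && (y \in e)) es.
  under eq_bigr do rewrite -sum1_count big_mkcond.
  rewrite exchange_big /=; apply: eq_bigr => e _.
  case: (boolP (x \in e)) => xe /=; last by rewrite big1.
  rewrite mul1n -big_mkcondr sum1_card [in LHS](cardsD1 x) xe /=.
  by apply: eq_card => y; rewrite !inE.
rewrite -(cardC1 x) -sum1_card; apply: leq_sum => y yx.
by apply: les; rewrite eq_sym.
Qed.

Let sum_mem (F : {set V} -> nat) :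
  \sum_x \sum_(e <- es) (x \in e) * F e = \sum_(e <- es) #|e| * F e.
Proof.
rewrite exchange_big /=; apply: eq_bigr => e _.
rewrite -big_distrl /=; congr (_ * _); rewrite -sum1_card [RHS]big_mkcond /=.
by apply: eq_bigr => x _; case: (x \in e).
Qed.

Let odd_nbrs x : odd (nbrs x) = odd (evens x).
Proof.
rewrite /nbrs /evens; elim: (es) => [|e s IH]; first by rewrite !big_nil.
rewrite !big_cons !oddD IH; congr (_ (+) _).
case: (boolP (x \in e)) => //= xe; rewrite !mul1n.
have : 0 < #|e| by apply/card_gt0P; exists x.
by case: #|e| => //= k _; rewrite negbK; case: (odd k).
Qed.

Let sum_nbrs : \sum_(e <- es) #|e| * #|e|.-1 <= m * m.-1.
Proof. by rewrite -sum_mem -sum_nat_const; apply: leq_sum => x _; apply: nbrs_le. Qed.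

(** Edge by edge, k (k - 1) + 6 - 4 k = (k - 2)(k - 3) is nonnegative for integers k. *)
Lemma linear_degree_le : 4 * D <= m * m.-1 + 6 * n.
Proof.
apply: leq_trans (leq_add sum_nbrs (leqnn _)).
rewrite -sum1_size !big_distrr -big_split /=; apply: leq_sum => e _.
by case: #|e| => [|[|[|k]]] //=; nia.
Qed.

(* At a vertex of degree sum m - 1, an odd number, some edge has even size. *)
Lemma linear_degree_le_even : ~~ odd m -> 14 * D + m <= 3 * (m * m.-1) + 24 * n.
Proof.
move=> em; have [m0|m_gt0] := posnP m.
  have D0 : D = 0.
    rewrite big1 // => e _; apply/eqP; rewrite cards_eq0; apply/eqP/setP => x.
    by have := fintype0 x m0.
  by rewrite D0 m0.
have par x : 1 + nbrs x <= m.-1 + evens x.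
  have le := nbrs_le x; have oe := odd_nbrs x.
  have [e|ne] := eqVneq (nbrs x) m.-1; last by lia.
  by have : odd (evens x); [rewrite -oe e; lia | rewrite e; lia].
have : m + \sum_(e <- es) #|e| * #|e|.-1
     <= m * m.-1 + \sum_(e <- es) #|e| * ~~ odd #|e|.
  rewrite -2!sum_mem -[X in X + _](muln1) -!sum_nat_const -!big_split /=.
  by apply: leq_sum => x _; apply: par.
(* Edge by edge, the difference of the sides is (k - 3)(3 k - 8) for odd k and 3 (k - 2)(k - 4) for
   even k; it vanishes at sizes 2, 3 and 4. *)
have : 14 * D + \sum_(e <- es) #|e| * ~~ odd #|e|
    <= 3 * (\sum_(e <- es) #|e| * #|e|.-1) + 24 * n.
  rewrite -sum1_size !big_distrr -!big_split /=; apply: leq_sum => e _.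
  by case: #|e| => [|[|[|[|[|[|k]]]]]] //=; nia.
by have := sum_nbrs; lia.
Qed.

(** [D = 3 n - 1] would be equality in the generic bound: all sizes are 2 or 3, every pair is
    covered, and exactly one edge has size 2. But [m - 1] is even, so each end of that edge lies in
    an even, positive number of even edges, and [evens] would sum to at least 4 instead of 2. *)
Lemma linear_degree_neq : odd m -> m * m.-1 + 4 = 6 * n -> D + 1 != 3 * n.
Proof.
move=> om mn; apply/eqP => Dn.
pose S := \sum_(e <- es) #|e| * #|e|.-1.
have slack : \sum_(e <- es) (#|e| * #|e|.-1 + 6 - 4 * #|e|) = 0.
  have : \sum_(e <- es) (#|e| * #|e|.-1 + 6 - 4 * #|e|) + 4 * D = S + 6 * n.
    rewrite /S -sum1_size !big_distrr -!big_split /=; apply: eq_bigr => e _.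
    by case: #|e| => [|[|[|k]]] //=; nia.
  by have := sum_nbrs; rewrite -/S; lia.
have S_eq : S = m * m.-1.
  have := sum_nbrs; have : 4 * D <= S + 6 * n; last by rewrite -/S; lia.
  rewrite /S -sum1_size !big_distrr -big_split /=; apply: leq_sum => e _.
  by case: #|e| => [|[|[|k]]] //=; nia.
have sz e : e \in es -> #|e| = 2 \/ #|e| = 3.
  move=> ein; have /eqP := slack; rewrite sum_nat_seq_eq0 => /allP/(_ _ ein) /=.
  by case: #|e| => [|[|[|[|k]]]] //=; nia.
have nb x : nbrs x = m.-1.
  have : \sum_x (m.-1 - nbrs x) = 0.
    have : \sum_x (m.-1 - nbrs x) + \sum_x nbrs x = m * m.-1.
      rewrite -big_split /= -sum_nat_const; apply: eq_bigr => y _.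
      by rewrite subnK.
    by rewrite sum_mem -/S; lia.
  move/eqP; rewrite sum_nat_eq0 => /forallP/(_ x) /=.
  by rewrite subn_eq0 => le; apply/eqP; rewrite eqn_leq nbrs_le.
have ev x : ~~ odd (evens x).
  by rewrite -odd_nbrs nb; have : 0 < m; [apply/card_gt0P; exists x | lia].
have Ev : \sum_x evens x = 2.
  rewrite sum_mem; have : \sum_(e <- es) #|e| * ~~ odd #|e| + 2 * D = 6 * n; last by lia.
  rewrite -sum1_size !big_distrr -big_split /= !big_seq; apply: eq_bigr => e ein.
  by case: (sz e ein) => ->.
have [e ein e2] : exists2 e, e \in es & #|e| = 2.
  have [/hasP[e ein /eqP e2]|/hasPn no] := boolP (has (fun e : {set V} => #|e| == 2) es).
    by exists e.
  have : D = 3 * n; last by lia.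
  rewrite -sum1_size big_distrr /= !big_seq; apply: eq_bigr => e ein.
  by case: (sz e ein) => // e2; have := no e ein; rewrite e2.
have : \sum_(x in e) 2 <= \sum_x evens x.
  rewrite [leqRHS](bigID (mem e)) /=; apply: leq_trans (leq_addr _ _).
  apply: leq_sum => x xe; have := ev x.
  have : 0 < evens x.
    rewrite /evens (big_rem e ein) /= xe e2 /=; lia.
  by case: (evens x) => [|[|k]].
by rewrite sum_nat_const e2 Ev.
Qed.

End UpperBounds.

Section Z22Bounds.
Variables m n : nat.
Hypothesis m_gt0 : 0 < m.

Lemma Z22_seq : exists (V : finType) (es : seq {set V}),
  [/\ linear_seq es, #|V| = m, size es = n & \sum_(e <- es) #|e| = Z22 m n].
Proof.
have [H [lin cV sE tD]] := Z22_attained n m_gt0.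
by exists (vertex H), (edges H).
Qed.

Lemma bin2_double k : 2 * 'C(k, 2) = k * k.-1.
Proof. by rewrite -[2]/(2`!) mulnC bin_ffact ffactnS ffactn1. Qed.

Lemma Z22_le : 2 * Z22 m n <= 'C(m, 2) + 3 * n.
Proof.
have [V [es [lin <- <- <-]]] := Z22_seq.
by have := linear_degree_le lin; rewrite -bin2_double; lia.
Qed.

Lemma Z22_le_even : ~~ odd m -> 14 * Z22 m n + m <= 6 * 'C(m, 2) + 24 * n.
Proof.
have [V [es [lin <- <- <-]]] := Z22_seq => em.
by have := linear_degree_le_even lin em; rewrite -bin2_double; lia.
Qed.

Lemma Z22_neq : odd m -> 'C(m, 2) + 2 = 3 * n -> (Z22 m n).+1 != 3 * n.
Proof.
have [V [es [lin <- <- <-]]] := Z22_seq => om mn; rewrite -addn1.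
by apply: linear_degree_neq => //; rewrite -bin2_double; lia.
Qed.

End Z22Bounds.

(** * Values of the Zarankiewicz numbers *)

Lemma bin2_even h : 'C(2 * h, 2) + h = 2 * (h * h).
Proof.
apply/eqP; rewrite -(eqn_pmul2l (isT : 0 < 2)) mulnDr bin2_double.
by case: h => [|h]; [|apply/eqP; rewrite mulnS /=; nia].
Qed.

Lemma bin2_succ_even h : 'C((2 * h).+1, 2) = 2 * (h * h) + h.
Proof. by apply/eqP; rewrite -(eqn_pmul2l (isT : 0 < 2)) bin2_double /=; apply/eqP; nia. Qed.

Lemma packing_degree_ge m n t p q d : packing m t q -> t + q + p = n ->
  3 * t + 6 * q + p <= 'C(m, 2) -> 3 * t + 4 * q + 2 * p = d -> d <= Z22 m n.
Proof.
by move=> P <- hp <-; apply: Z22_ub; apply: packing_total_degree.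
Qed.

(** With t triples and n - t pairs the degree is 2 n + t, and n + 2 t pairs of vertices are covered;
    the chosen t is the largest that fits. *)
Lemma packing_half_le m n : 'C(m, 2) <= 3 * n -> n <= 'C(m, 2) ->
  packing m (('C(m, 2) - n) %/ 2) 0 -> ('C(m, 2) + 3 * n) %/ 2 <= Z22 m n.
Proof.
move=> C3 nC P; set t := _ %/ 2 in P.
have tE : t = ('C(m, 2) - n) %/ 2 by [].
by apply: (packing_degree_ge (p := n - t) P); move: tE C3 nC; clearbody t; clear; lia.
Qed.

Lemma mod3_square h : (h * h) %% 3 = (h %% 3 != 0).
Proof.
rewrite -modnMm; have : h %% 3 < 3 by rewrite ltn_mod.
by case: (h %% 3) => [|[|[|]]].
Qed.

Lemma Z22_odd m n : odd m -> 'C(m, 2) <= 3 * n -> n <= 'C(m, 2) ->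
  ~~ ((m %% 6 == 5) && (3 * n == 'C(m, 2) + 2)) ->
  Z22 m n = ('C(m, 2) + 3 * n) %/ 2.
Proof.
move=> om C3 nC spec; apply/eqP; rewrite eqn_leq; apply/andP; split.
  by have m_gt0 : 0 < m; [case: (m) om|have := Z22_le n m_gt0; lia].
apply: packing_half_le => //.
have [h mE] : exists h, m = (2 * h).+1 by exists m./2; lia.
rewrite mE bin2_succ_even in C3 nC spec *.
have sq := mod3_square h.
(* For [h] congruent to 2 mod 3 one quadruple is forced and four pairs stay uncovered; the triples
   still suffice unless [3 * n = 'C(m, 2) + 2], the excluded case. *)
apply: (@packing_odd h (h %% 3 == 2)).
  by rewrite /gdd24_ok; case: (h %% 3 == 2) / eqP => /= h2; lia.
rewrite -mulnA; move: C3 nC spec sq; set s := h * h; clearbody s; clear.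
have [e|e] := eqVneq (h %% 3) 2; lia.
Qed.

Lemma Z22_odd_special m n : m %% 6 = 5 -> 3 * n = 'C(m, 2) + 2 ->
  Z22 m n = ('C(m, 2) + 3 * n) %/ 2 - 1.
Proof.
move=> m5 nE; have m_gt0 : 0 < m by lia.
apply/eqP; rewrite eqn_leq; apply/andP; split.
  have := Z22_le n m_gt0; have : (Z22 m n).+1 != 3 * n by apply: Z22_neq => //; lia.
  by move: nE; clear; lia.
have [h mE] : exists h, m = (2 * h).+1 by exists m./2; lia.
have h2 : h %% 3 = 2 by lia.
have sq := mod3_square h; have CE := bin2_succ_even h; rewrite mE in nE m5 *.
(* One quadruple gives [n - 2] triples and four uncovered pairs; two of these serve as edges, for a
   total degree of 3 n - 2. *)
have ok1 : gdd24_ok h 1 by rewrite /gdd24_ok h2; lia.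
have P : packing (2 * h).+1 (n - 2) 0.
  apply: (packing_odd ok1); rewrite -mulnA; move: nE CE sq h2.
  set s := h * h; clearbody s; clear; lia.
apply: (packing_degree_ge (p := 2) P); move: nE CE m5; clear;
  by set C := 'C(_, _); clearbody C; lia.
Qed.

Lemma Z22_even_large m n : ~~ odd m -> 0 < m -> n <= 'C(m, 2) ->
  'C(m, 2) + m < 3 * n -> Z22 m n = ('C(m, 2) + 3 * n) %/ 2.
Proof.
move=> em m_gt0 nC Cn; apply/eqP; rewrite eqn_leq; apply/andP; split.
  by have := Z22_le n m_gt0; lia.
apply: packing_half_le => //; first by lia.
have [h mE] : exists h, m = 2 * h by exists m./2; lia.
have CE := bin2_even h; rewrite mE in nC Cn m_gt0 *.
set t := _ %/ 2; have tE : t = ('C(2 * h, 2) - n) %/ 2 by [].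
clearbody t; move: tE nC Cn CE; set C := 'C(_, 2); clearbody C => tE nC Cn CE.
have sq := mod3_square h.
have [h3|h3] := eqVneq (h %% 3) 2.
  (* The single forced quadruple is shrunk to the last of the triples; [t.-1.+1] also admits
     [t = 0]. *)
  apply: (@packing_le _ t.-1.+1 0) => //; first by lia.
  apply: packing_quad_triple; apply: packing_even; first by rewrite /gdd24_ok h3; lia.
  have : 2 * h <= h * h by rewrite leq_mul2r; lia.
  rewrite -mulnA; move: tE nC Cn CE; set s := h * h; clearbody s; clear -h3; lia.
apply: packing_even; first by rewrite /gdd24_ok (negbTE h3); lia.
by rewrite -mulnA; move: tE nC Cn CE; set s := h * h; clearbody s; clear; lia.
Qed.

(* With C = 'C(2h, 2), a design of type 2^(h-2b) 4^b has (C + 2h - 7b) / 3 edges in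
   all.  For the nearest such b, n differs from it by some d with |d| <= 3, and d
   is absorbed by omitting pairs and replacing a quadruple by a triple and three
   pairs. *)
Lemma Z22_even_small m n : ~~ odd m -> 0 < m -> 'C(m, 2) <= 3 * n ->
  3 * n <= 'C(m, 2) + m -> Z22 m n = (6 * 'C(m, 2) + 24 * n - m) %/ 14.
Proof.
move=> em m_gt0 C3 nC; apply/eqP; rewrite eqn_leq; apply/andP; split.
  by have := Z22_le_even n m_gt0 em; lia.
have [h mE] : exists h, m = 2 * h by exists m./2; lia.
have CE := bin2_even h; rewrite mE in nC C3 m_gt0 *; clear em mE m.
have sq := mod3_square h.
pose r := (h %% 3 == 2) : nat.
(* By [yE] below, the design with [b = r + 3 * k] quadruples has n + y - 2 r - 7 k edges, groups
   included; [k] is rounded so that this is within 3 of [n]. *)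
pose y := ('C(2 * h, 2) + 2 * h - 3 * n) %/ 3.
pose k := (y + 3 - 2 * r) %/ 7.
pose b := r + 3 * k.
have yE : 3 * n + 3 * y + r = 'C(2 * h, 2) + 2 * h.
  rewrite /y /r; move: sq CE nC; set C := 'C(_, _); set s := h * h; clearbody C s; clear.
  by have [e|e] := eqVneq (h %% 3) 2; lia.
have kE : [/\ y <= 2 * r + 7 * k + 3 & 2 * r + 7 * k <= y + 3].
  by rewrite /k; have : r <= 1 by [rewrite /r; case: eqP]; split; lia.
have r1 : r <= 1 by rewrite /r; case: eqP.
have rh : r <= h./2 by rewrite /r; case: eqP => //; lia.
have [kE1 kE2] := kE.
have hs : (h <= 1) || (2 * h <= h * h) by rewrite leq_mul2r; lia.
have okb : gdd24_ok h b.
  move: yE C3; set C := 'C(_, _); clearbody C y k => yE C3.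
  rewrite /gdd24_ok -/r /b; clearbody r.
  by apply/and3P; split; clear -r1 rh yE C3 kE1 kE2; lia.
have [T TE] : exists T, 3 * T + 2 * h + 4 * b = 2 * (h * h).
  exists ((2 * (h * h) - 2 * h - 4 * b) %/ 3); move: sq hs okb.
  rewrite /gdd24_ok -/r => + + /and3P[/eqP b3 b2 _]; move: b3 rh; rewrite /r.
  set s := h * h; clearbody s b; clear -b2.
  by have [e|e] := eqVneq (h %% 3) 2; lia.
have P : packing (2 * h) T b by apply: packing_even => //; rewrite TE mulnA.
move: yE C3 CE TE okb; set C := 'C(_, _) => yE C3 CE TE /and3P[_ b2 _].
have bE : b = r + 3 * k by [].
set s := h * h in CE TE; set z := _ %/ 14.
have zE : z = (6 * C + 24 * n - 2 * h) %/ 14 by [].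
have CC : 'C(2 * h, 2) = C by [].
clearbody z b k y r s C; clear hs sq.
(* Of the [h - 2 * b] groups of size 2 the surplus is omitted. In the other case [b] is positive,
   and up to three pairs of a shrunken quadruple make up the deficit. *)
have [d0|d0] := leqP (2 * r + 7 * k) y.
  apply: leq_trans (packing_degree_ge (n := n)
    (p := h + 2 * r + 7 * k - 2 * b - y) P _ _ erefl); by clear P; lia.
case: b P bE b2 TE => [|b'] P bE b2 TE; first by clear P; lia.
apply: leq_trans (packing_degree_ge (n := n) (p := h + 2 * r + 7 * k - 2 * b'.+1 - y)
  (packing_quad_triple P) _ _ erefl); by clear P; lia.
Qed.

(** * Translation of rational floors and ceilings into quotients of naturals *)

Local Open Scope ring_scope.

Lemma floor_divn (a d : nat) : (0 < d)%N ->
  Num.floor (a%:R / d%:R : rat) = (a %/ d)%:Z.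
Proof.
move=> d0; apply: floor_def; rewrite intrD -[(a %/ d)%:Z%:~R]/((a %/ d)%:R).
rewrite ler_pdivlMr ?ltr0n // ltr_pdivrMr ?ltr0n // natr1 -!natrM ler_nat ltr_nat.
by rewrite leq_divM /= ltn_ceil.
Qed.

Lemma ceil_third (a : nat) :
  Num.ceil (1 / 3 * a%:R : rat) = ((a + 2) %/ 3)%:Z.
Proof.
apply: ceil_def; rewrite intrB -[((a + 2) %/ 3)%:Z%:~R]/(((a + 2) %/ 3)%:R).
have : (a <= 3 * ((a + 2) %/ 3) < a + 3)%N by apply/andP; split; lia.
rewrite -(ler_nat rat) -(ltr_nat rat) natrD natrM => /andP[h1 h2].
by apply/andP; split; lra.
Qed.

Theorem theorem1p1 (m n : nat) (m_gt0 : (0 < m)%N) (n_gt0 : (0 < n)%N)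
  (n_ge : 1 / 3 * 'C(m, 2)%:R <= n%:R :> rat) (n_le : (n <= 'C(m, 2))%N) :
  (Z22 m n)%:Z =
    if ~~ odd m
       && (n%:Z <= Num.floor (1 / 3 * 'C(m, 2)%:R + m%:R / 3 : rat))
    then Num.floor (1 / 14 * m%:R * (3 * m%:R - 4) + 12 / 7 * n%:R : rat)
    else if (m == 5 %[mod 6]) && (n%:Z == Num.ceil (1 / 3 * 'C(m, 2)%:R : rat))
    then Num.floor (1 / 4 * m%:R * (m%:R - 1) + 3 / 2 * n%:R : rat) - 1
    else Num.floor (1 / 4 * m%:R * (m%:R - 1) + 3 / 2 * n%:R : rat).
Proof.
have C3 : ('C(m, 2) <= 3 * n)%N.
  by rewrite -(ler_nat rat) natrM; lra.
have CE : 'C(m, 2)%:R = m%:R * (m%:R - 1) / 2 :> rat.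
  have := congr1 (fun k => k%:R : rat) (bin2_double m); rewrite /= !natrM.
  by rewrite -subn1 natrB // => h; lra.
(* Keeps the truncated subtraction of [m] below exact under the cast to rationals. *)
have mC : (m <= 6 * 'C(m, 2) + 24 * n)%N.
  have := bin2_double m; clear -n_gt0 n_le.
  by case: m n_le => [|[|m]] //= n_le e; nia.
have -> : 1 / 3 * 'C(m, 2)%:R + m%:R / 3 = ('C(m, 2) + m)%:R / 3%:R :> rat.
  by rewrite natrD; lra.
have -> : 1 / 14 * m%:R * (3 * m%:R - 4) + 12 / 7 * n%:R
    = (6 * 'C(m, 2) + 24 * n - m)%:R / 14%:R :> rat.
  by rewrite natrB // natrD !natrM CE; field.
have -> : 1 / 4 * m%:R * (m%:R - 1) + 3 / 2 * n%:R
    = ('C(m, 2) + 3 * n)%:R / 2%:R :> rat.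
  by rewrite natrD !natrM CE; field.
rewrite !floor_divn // ceil_third lez_nat leq_divRL // mulnC.
case: ifP => [/andP[em n3]|ne]; first by rewrite Z22_even_small.
case: ifP => [/andP[m5 /eqP[nE]]|nspec].
  have m5' : (m %% 6 = 5)%N by apply/eqP.
  (* With this residue the ceiling condition on [n] reads [3 * n = 'C(m, 2) + 2]. *)
  have C1 : ('C(m, 2) %% 3 = 1)%N.
    have [k mE] : exists k, m = (6 * k + 5)%N by exists (m %/ 6)%N; lia.
    have : ('C(m, 2) = 18 * (k * k) + 27 * k + 10)%N; last by lia.
    by have := bin2_double m; rewrite {2 3}mE addnS /=; nia.
  rewrite Z22_odd_special //; last by lia.
  by lia.
case: (boolP (odd m)) ne nspec => om /= ne nspec.
  rewrite Z22_odd //; apply/negP => /andP[m5 /eqP nE]; move: nspec.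
  by rewrite m5 /= => /eqP[]; congr Posz; lia.
by rewrite Z22_even_large //; lia.
Qed.
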